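(* $mnl(K_{2,2,1,1,1}) = 1$.
   Context: $K_{n_1,\dots,n_k}$ denotes the complete $k$-partite graph with parts of sizes $n_1,\dots,n_k$. An embedding of a finite graph $G$ means a tame embedding of $G$ in $\mathbb{R}^3$. A link in an embedding is an unordered pair of vertex-disjoint (simple closed) cycles of $G$ whose images form a non-trivial (non-split) two-component link (no three pairwise disjoint cycles exist in the graph considered here); links are counted as pairs of cycles. $mnl(G)$ is the minimal number of links in any embedding of $G$ in $\mathbb{R}^3$. *)

(* Defs.v *)
(* MathComp + MathComp-Analysis; R^3 is 'rV[R]_3 over an arbitrary R : realType. *)
From HB Require Import structures.
From mathcomp Require Import all_boot all_order all_algebra.
From mathcomp Require Import all_classical all_reals all_analysis.

Set Implicit Arguments.
Unset Strict Implicit.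
Unset Printing Implicit Defensive.

Import Order.TTheory GRing.Theory Num.Theory.
Import numFieldNormedType.Exports.

Local Open Scope classical_set_scope.
Local Open Scope ring_scope.

Record sgraph := SGraph {
  vertex :> finType;
  adj : rel vertex;
  adj_sym : symmetric adj;
  adj_irr : irreflexive adj }.

Section CompleteMultipartite.
Variable s : seq nat.

Definition multipartite_vertex := {i : 'I_(size s) & 'I_(nth 0%N s i)}.

Definition multipartite_adj : rel multipartite_vertex :=
  fun x y => tag x != tag y.

Lemma multipartite_adj_sym : symmetric multipartite_adj.
Proof. by move=> x y; rewrite /multipartite_adj eq_sym. Qed.

Lemma multipartite_adj_irr : irreflexive multipartite_adj.
Proof. by move=> x; rewrite /multipartite_adj eqxx. Qed.

Definition complete_multipartite : sgraph :=
  SGraph multipartite_adj_sym multipartite_adj_irr.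

End CompleteMultipartite.

(* A cycle subgraph is determined by, and identified with, its edge set;
   its vertex set is then [finset.cover C]. *)
Definition is_cycle (G : sgraph) (C : {set {set G}}) : Prop :=
  exists c : seq G, [/\ (2 < size c)%N, ucycle (@adj G) c &
    C = [set [set x; next c x] | x in c]%SET].

Section Geometry.
Variable R : realType.

Definition segment n (a b : 'rV[R]_n) : set 'rV[R]_n :=
  [set (1 - t) *: a + t *: b | t in `[0, 1]].

Fixpoint polyline n (p : 'rV[R]_n) (s : seq 'rV[R]_n) : set 'rV[R]_n :=
  if s is q :: s' then segment p q `|` polyline q s' else [set p].

Definition homeomorphism (S T : topologicalType) (h : S -> T) : Prop :=
  exists g : T -> S, [/\ cancel h g, cancel g h, continuous h & continuous g].

Definition sqnorm n (x : 'rV[R]_n) : R := \sum_(i < n) x 0 i ^+ 2.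

(* A tame 2-sphere in R^3 is the image of the round unit sphere under a
   self-homeomorphism h of R^3; the two components of its complement are the
   images of the open ball and of the exterior.  A and B are split when such a
   sphere, disjoint from both, has them on different sides. *)
Definition split_by_sphere (A B : set 'rV[R]_3) : Prop :=
  exists h : 'rV[R]_3 -> 'rV[R]_3, homeomorphism h /\
    let inside := h @` [set x | sqnorm x < 1] in
    let outside := h @` [set x | 1 < sqnorm x] in
    (A `<=` inside /\ B `<=` outside) \/ (A `<=` outside /\ B `<=` inside).

Section Realization.
Variable G : sgraph.

Definition vertex_point (v : G) : 'rV[R]_#|G| := delta_mx 0 (enum_rank v).

Definition edge_segment (u v : G) : set 'rV[R]_#|G| :=
  segment (vertex_point u) (vertex_point v).

(* The case u = v accounts for the vertices, isolated ones included. *)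
Definition realization : set 'rV[R]_#|G| :=
  [set x | exists u v : G, (u == v) || adj u v /\ edge_segment u v x].

(* The realization is compact, so a continuous injection of it into R^3 is a
   homeomorphism onto its image. *)
Definition embedding (f : 'rV[R]_#|G| -> 'rV[R]_3) : Prop :=
  {within realization, continuous f} /\
  {in realization &, injective f}.

(* Tame: some self-homeomorphism of R^3 makes every edge polygonal. *)
Definition tame_embedding (f : 'rV[R]_#|G| -> 'rV[R]_3) : Prop :=
  embedding f /\
  exists2 h : 'rV[R]_3 -> 'rV[R]_3, homeomorphism h &
    forall u v : G, adj u v -> exists s : seq 'rV[R]_3,
      last (h (f (vertex_point u))) s = h (f (vertex_point v)) /\
      (h \o f) @` edge_segment u v = polyline (h (f (vertex_point u))) s.

Definition cycle_image (f : 'rV[R]_#|G| -> 'rV[R]_3) (C : {set {set G}}) :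
    set 'rV[R]_3 :=
  [set y | exists u v : G,
     [set u; v]%SET \in C /\ (f @` edge_segment u v) y].

Definition is_link (f : 'rV[R]_#|G| -> 'rV[R]_3) (P : {set {set {set G}}}) :
    Prop :=
  exists C1 C2 : {set {set G}},
    [/\ P = [set C1; C2]%SET, is_cycle C1, is_cycle C2,
        (finset.cover C1 :&: finset.cover C2 = finset.set0)%SET &
        ~ split_by_sphere (cycle_image f C1) (cycle_image f C2)].

Definition nb_links (f : 'rV[R]_#|G| -> 'rV[R]_3) : nat :=
  #|[set P : {set {set {set G}}} | `[< is_link f P >]]%SET|.

(* The default value 0 is only relevant if there were no tame embedding. *)
Definition mnl : nat :=
  xget 0%N [set m : nat |
    (exists2 f, tame_embedding f & nb_links f = m) /\
    (forall f, tame_embedding f -> (m <= nb_links f)%N)].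

End Realization.
End Geometry.

(* Main.v *)
From Stdlib Require Import ZArith.
Require Import Defs.
From mathcomp Require Import all_boot all_order all_algebra.
From mathcomp Require Import all_classical all_reals all_analysis.
From mathcomp Require Import ring lra ssrZ zify.

Set Implicit Arguments.
Unset Strict Implicit.
Unset Printing Implicit Defensive.

Import Order.TTheory GRing.Theory Num.Theory.
Import numFieldNormedType.Exports.

Local Open Scope classical_set_scope.
Local Open Scope ring_scope.

(** The vertices of K_{2,2,1,1,1} are a, a', b, b', c, d, e, where a a' and b b'
    are the missing edges.

    _Every embedding has a link._  The graph contains K_{3,3,1}, with parts
    {a, a', c}, {b, b', d} and {e}.  In K_{3,3,1} each edge v w that avoids the
    apex z gives a pair of disjoint cycles: the triangle z v w, and the 4-cycle on
    the other four vertices.  The sum of the nine linking parities is odd.  Indeed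
    write the linking parity of two cycles as the number of times, modulo 2, that
    an edge of the first passes over an edge of the second.  In the sum over the
    nine pairs, an edge at z and an edge of K_{3,3} occur together twice or not at
    all, while two disjoint edges of K_{3,3} occur together once in each order, so
    that the sum counts the crossings between disjoint edges in a plane drawing of
    K_{3,3}; their number is odd by van Kampen ([K33_crossings],
    [K331_linking]).

    Linking parity is defined for polygons in general position, from the signs of
    the determinants of their vertices.  All that it needs is the effect of adding
    the boundary of a triangle ([overcross_triangle]), and this is a statement on
    five points whose signs obey the Grassmann-Pluecker relations.  A continuous
    embedding is replaced by a fine polygonal approximation, perturbed into general
    position ([generic_extend]).  If two cycles are on different sides of a
    topological sphere, the inner one contracts inside it; following the
    contraction by small polygonal steps, each of which moves the polygon across
    triangles that miss the other one, shows that the linking parity of fine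
    approximations vanishes ([contractible_linking], [split_linking]).  So some
    pair of cycles is not split ([K331_link]).

    _One link is enough._  Place the vertices at seven points of the integer
    lattice, no four of them coplanar, and draw the edges straight
    ([straight_tame]).  Disjoint cycles have lengths 3 and 3, or 3 and 4.  For the
    points chosen, in every pair except the triangle c d e with the 4-cycle
    a b a' b', one of the cycles is a triangle whose flat disc is disjoint from
    the other cycle: an enumeration of determinant signs ([check33_all],
    [check34_all]).  The boundary of a thin plate around the disc is then a sphere
    that splits the pair ([split_flat_triangle]), so there is at most one link
    ([only_link]). *)

(** * Orientations and the Grassmann-Pluecker relations *)

(** The sign bits that x - y + z = 0 allows for nonzero x, y and z. *)
Definition gp_signs (x y z : bool) : bool := ~~ ((x (+) y) && (y (+) z)).

Section Orientation.
Variable R : realFieldType.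
Local Notation pt := 'rV[R]_3.
Implicit Types a b c d o p q u v w : pt.

Definition cx a : R := a ord0 (@Ordinal 3 0 isT).
Definition cy a : R := a ord0 (@Ordinal 3 1 isT).
Definition cz a : R := a ord0 (@Ordinal 3 2 isT).

(** Projections are always along the third axis: [area] is the orientation
    determinant of the projected points, and the derivative of [vol a b c] in the
    vertical direction. *)
Definition area a b c : R :=
  (cx b - cx a) * (cy c - cy a) - (cy b - cy a) * (cx c - cx a).

Definition vol a b c d : R :=
  let u := (cx b - cx a, cy b - cy a, cz b - cz a) in
  let v := (cx c - cx a, cy c - cy a, cz c - cz a) in
  let w := (cx d - cx a, cy d - cy a, cz d - cz a) in
  u.1.1 * (v.1.2 * w.2 - v.2 * w.1.2) - u.1.2 * (v.1.1 * w.2 - v.2 * w.1.1)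
  + u.2 * (v.1.1 * w.1.2 - v.1.2 * w.1.1).

Definition area_neg a b c : bool := area a b c < 0.
Definition vol_neg a b c d : bool := vol a b c d < 0.

Lemma oppr_neg (x : R) : x != 0 -> (- x < 0) = ~~ (x < 0).
Proof. by move=> x0; rewrite oppr_lt0 -leNgt le_eqVlt eq_sym (negPf x0). Qed.

Lemma mulr_neg (x y : R) : x != 0 -> y != 0 -> (x * y < 0) = (x < 0) (+) (y < 0).
Proof.
move=> x0 y0; have [hx|hx] := boolP (x < 0).
  by rewrite nmulr_rlt0 // -[0 < y]oppr_lt0 oppr_neg.
have xp : 0 < x by rewrite lt_neqAle eq_sym x0 leNgt.
by rewrite pmulr_rlt0.
Qed.

Lemma gp_signsP (x y z : R) : x - y + z = 0 -> x != 0 -> y != 0 -> z != 0 ->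
  gp_signs (x < 0) (y < 0) (z < 0).
Proof.
move=> e x0 y0 z0; rewrite /gp_signs.
case: (ltrgtP x 0) x0 => // hx _; case: (ltrgtP y 0) y0 => // hy _;
case: (ltrgtP z 0) z0 => // hz _; lra.
Qed.

Lemma gp_area o w x y z : 
  area o w x != 0 -> area o y z != 0 -> area o w y != 0 -> area o x z != 0 ->
  area o w z != 0 -> area o x y != 0 ->
  gp_signs (area_neg o w x (+) area_neg o y z) (area_neg o w y (+) area_neg o x z)
    (area_neg o w z (+) area_neg o x y).
Proof.
move=> h1 h2 h3 h4 h5 h6; rewrite /area_neg -!mulr_neg //.
by apply: gp_signsP; rewrite ?mulf_neq0 // /area; ring.
Qed.

Lemma gp_vol a b w x y : 
  vol a b w x != 0 -> area a b y != 0 -> vol a b w y != 0 -> area a b x != 0 ->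
  area a b w != 0 -> vol a b x y != 0 ->
  gp_signs (vol_neg a b w x (+) area_neg a b y) (vol_neg a b w y (+) area_neg a b x)
    (area_neg a b w (+) vol_neg a b x y).
Proof.
move=> h1 h2 h3 h4 h5 h6; rewrite /area_neg /vol_neg -!mulr_neg //.
by apply: gp_signsP; rewrite ?mulf_neq0 // /area /vol /=; ring.
Qed.

Lemma areaC a b c : area b a c = - area a b c.
Proof. by rewrite /area; ring. Qed.
Lemma areaR a b c : area b c a = area a b c.
Proof. by rewrite /area; ring. Qed.
Lemma volC a b c d : vol b a c d = - vol a b c d.
Proof. by rewrite /vol /=; ring. Qed.
Lemma volS a b c d : vol c d a b = vol a b c d.
Proof. by rewrite /vol /=; ring. Qed.

(** This is about the projected segments. *)
Definition crosses a b p q : bool :=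
  (area_neg a b p (+) area_neg a b q) && (area_neg p q a (+) area_neg p q b).

(** At a crossing, moving up by h from p q to a b satisfies
    h * area a b p = - t * vol a b p q for some t > 0, so that a b is the upper
    segment exactly when the two determinants have opposite signs. *)
Definition overcross a b p q : bool := crosses a b p q &&
  (vol_neg a b p q (+) area_neg a b p).

Definition inside a b c p : bool :=
  (area_neg a b p == area_neg b c p) && (area_neg b c p == area_neg c a p).

(** p is below the plane of the triangle and projects inside it. *)
Definition below a b c p : bool := inside a b c p &&
  (vol_neg a b c p (+) area_neg a b c).

Definition pierces a b c p q : bool :=
  [&& vol_neg a b c p (+) vol_neg a b c q, vol_neg p q a b == vol_neg p q b c & vol_neg
    p q b c == vol_neg p q c a].

(** The projection of p lies in the angle (less than pi) at o between a and b. *)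
Definition wedge o a b p : bool := (area_neg o a p == area_neg o a b) &&
  (area_neg o p b == area_neg o a b).

(** Distinct abscissae for distinct points make [area a b] nonconstant, and nonzero
    areas make [vol a b c] nonconstant; hence a generic family can always be
    extended by a point close to any given one. *)
Definition generic (S : seq pt) : Prop :=
  [/\ {in S &, forall a b, a != b -> cx a != cx b},
      {in S & &, forall a b c, uniq [:: a; b; c] -> area a b c != 0} &
      {in S & &, forall a b c, {in S, forall d,
        uniq [:: a; b; c; d] -> vol a b c d != 0}}].

Lemma generic_sub (S T : seq pt) : {subset S <= T} -> generic T -> generic S.
Proof.
move=> sST [h1 h2 h3]; split.
- by move=> a b /sST ? /sST ?; apply: h1.
- by move=> a b c /sST ? /sST ? /sST ?; apply: h2.
- by move=> a b c /sST ? /sST ? /sST ? d /sST ?; apply: h3.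
Qed.

Lemma area_negC a b c : area a b c != 0 -> area_neg b a c = ~~ area_neg a b c.
Proof. by move=> h; rewrite /area_neg areaC oppr_neg. Qed.
Lemma area_negR a b c : area_neg b c a = area_neg a b c.
Proof. by rewrite /area_neg areaR. Qed.
Lemma area_negX a b c : area a b c != 0 -> area_neg a c b = ~~ area_neg a b c.
Proof. by move=> h; rewrite /area_neg -oppr_neg //; congr (_ < 0); rewrite /area;
  ring. Qed.
Lemma vol_negC a b c d : vol a b c d != 0 -> vol_neg b a c d = ~~ vol_neg a b c d.
Proof. by move=> h; rewrite /vol_neg volC oppr_neg. Qed.
Lemma vol_negS a b c d : vol_neg c d a b = vol_neg a b c d.
Proof. by rewrite /vol_neg volS. Qed.

Lemma generic_area (S : seq pt) a b c : generic S -> a \in S -> b \in S -> c \in S ->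
  a != b -> a != c -> b != c -> area a b c != 0.
Proof.
by move=> [_ g _] aS bS cS ab ac bc; apply: g; rewrite //= !inE !negb_or ab ac bc.
Qed.

Lemma generic_vol (S : seq pt) a b c d : generic S ->
  a \in S -> b \in S -> c \in S -> d \in S ->
  a != b -> a != c -> a != d -> b != c -> b != d -> c != d -> vol a b c d != 0.
Proof.
move=> [_ _ g] aS bS cS dS ab ac ad bc bd cd.
by apply: g; rewrite //= !inE !negb_or ab ac ad bc bd cd.
Qed.

End Orientation.

Definition forall_bool (P : bool -> bool) := P true && P false.
Lemma forall_boolP P : forall_bool P -> forall b, P b.
Proof. by move=> /andP[? ?] []. Qed.

(** The variable [abp] stands for the sign of [area a b p], and so on. *)
Definition planar_check (abc abp abq acp acq apq bcp bcq bpq cpq : bool) : bool :=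
  gp_signs (abq (+) cpq) (acq (+) bpq) (apq (+) bcq) ==>
  gp_signs (abp (+) ~~ cpq) (acp (+) ~~ bpq) (~~ apq (+) bcp) ==>
  (let cr x y z t := (x (+) y) && (z (+) t) in
   let ins x y z := (x == y) && (y == z) in
  (cr abp abq apq bpq (+) cr bcp bcq bpq cpq (+) cr (~~ acp) (~~ acq) cpq apq) ==
    (ins abp bcp (~~ acp) (+) ins abq bcq (~~ acq))).

Lemma planar_check_true : forall_bool
  (fun b1 => forall_bool (fun b2 => forall_bool (fun b3 => forall_bool (fun b4 =>
 forall_bool (fun b5 => forall_bool (fun b6 => forall_bool
   (fun b7 => forall_bool (fun b8 => forall_bool (fun b9 =>
 forall_bool (fun b10 => planar_check b1 b2 b3 b4 b5 b6 b7 b8 b9 b10)))))))))).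
Proof. by vm_compute. Qed.

Lemma planar_checkP b1 b2 b3 b4 b5 b6 b7 b8 b9 b10 : planar_check b1 b2 b3 b4 b5 b6 b7
  b8 b9 b10.
Proof. exact: (forall_boolP (forall_boolP
  (forall_boolP (forall_boolP (forall_boolP
  (forall_boolP (forall_boolP (forall_boolP
  (forall_boolP (forall_boolP  planar_check_true b1) b2) b3) b4) b5) b6) b7) b8) b9)
  b10). Qed.

(** Three letters stand for the sign of an area, four for the sign of a volume. *)
Definition spatial_check (abc abp abq acp acq apq bcp bcq bpq cpq abcp abcq abpq acpq
  bcpq : bool) : bool :=
  gp_signs (~~ abcp (+) bpq) (abpq (+) ~~ bcp) (abp (+) ~~ bcpq) ==>
  gp_signs (~~ abcq (+) ~~ bpq) (~~ abpq (+) ~~ bcq) (abq (+) bcpq) ==>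
  gp_signs (~~ abc (+) bpq) (~~ abp (+) bcq) (~~ abq (+) bcp) ==>
  gp_signs (abcp (+) cpq) (acpq (+) bcp) (acp (+) bcpq) ==>
  gp_signs (abcq (+) ~~ cpq) (~~ acpq (+) bcq) (acq (+) ~~ bcpq) ==>
  gp_signs (abc (+) cpq) (~~ acp (+) ~~ bcq) (~~ acq (+) ~~ bcp) ==>
  gp_signs (abpq (+) cpq) (acpq (+) bpq) (apq (+) bcpq) ==>
  gp_signs (abp (+) ~~ cpq) (acp (+) ~~ bpq) (~~ apq (+) bcp) ==>
  gp_signs (abq (+) cpq) (acq (+) bpq) (apq (+) bcq) ==>
  (let ov x y z t u := [&& x (+) y, z (+) t & u (+) x] in
   let bel x y z o u := [&& x == y, y == z & u (+) o] in
   let hit u v x y z := [&& u (+) v, x == y & y == z] in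
  (ov abp abq apq bpq abpq (+) ov bcp bcq bpq cpq bcpq
     (+) ov (~~ acp) (~~ acq) cpq apq (~~ acpq)) ==
    (bel abp bcp (~~ acp) abc abcp (+) bel abq bcq (~~ acq) abc abcq
     (+) hit abcp abcq abpq bcpq (~~ acpq))).

Lemma spatial_check_true : forall_bool
  (fun b1 => forall_bool (fun b2 => forall_bool
  (fun b3 => forall_bool (fun b4 => forall_bool
  (fun b5 => forall_bool (fun b6 => forall_bool
  (fun b7 => forall_bool (fun b8 => forall_bool
  (fun b9 => forall_bool (fun b10 => forall_bool
  (fun b11 => forall_bool (fun b12 => forall_bool
  (fun b13 => forall_bool (fun b14 => forall_bool
  (fun b15 => spatial_check b1 b2 b3 b4 b5 b6 b7 b8 b9 b10 b11 b12 b13 b14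
  b15))))))))))))))).
Proof. by vm_compute. Qed.

Lemma spatial_checkP b1 b2 b3 b4 b5 b6 b7 b8 b9 b10 b11 b12 b13 b14 b15 : spatial_check
  b1 b2 b3 b4 b5 b6 b7 b8 b9 b10 b11 b12 b13 b14 b15.
Proof. exact: (forall_boolP (forall_boolP
  (forall_boolP (forall_boolP (forall_boolP
  (forall_boolP (forall_boolP (forall_boolP
  (forall_boolP (forall_boolP (forall_boolP
  (forall_boolP (forall_boolP (forall_boolP (forall_boolP  spatial_check_true b1) b2)
  b3) b4) b5) b6) b7) b8) b9) b10) b11) b12) b13) b14) b15). Qed.

Local Ltac distinct_from H :=
  move: H; rewrite /= ?inE ?negb_or -?andbA; do ?[case/andP=> ?]; move=> *;
  rewrite /= ?inE ?negb_or -?andbA; do ?[apply/andP; split];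
  first [done | assumption | by rewrite eq_sym].

Local Ltac unpack_distinct sS uS :=
  have := uS; rewrite /= ?inE ?negb_or -?andbA; do ?[case/andP=> ?]; move=> _;
  have := introT allP sS; rewrite /=; do ?[case/andP=> ?]; move=> _.
Local Ltac nondegenerate gS :=
  match goal with |- is_true (area _ _ _ != 0) => apply: (generic_area gS)
                | |- is_true (vol _ _ _ _ != 0) => apply: (generic_vol gS) end;
  first [assumption | by rewrite eq_sym].

Section FivePoints.
Variable R : realFieldType.
Local Notation pt := 'rV[R]_3.
Implicit Types (a b c d p q : pt) (S : seq pt).

(** Only the ten orientation bits of the five points matter.  The relations with
    pivots p and q exclude all the bit patterns that violate the identity. *)
Lemma crosses_triangle S a b c p q : generic S ->
  {subset [:: a; b; c; p; q] <= S} -> uniq [:: a; b; c; p; q] ->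
  (crosses a b p q (+) crosses b c p q (+) crosses c a p q) =
  (inside a b c p (+) inside a b c q).
Proof.
move=> gS sS uS; unpack_distinct sS uS.
have gq : gp_signs (area_neg q a b (+) area_neg q c p)
  (area_neg q a c (+) area_neg q b p) (area_neg q a p (+) area_neg q b c).
  by apply: gp_area; nondegenerate gS.
have gp' : gp_signs (area_neg p a b (+) area_neg p c q)
  (area_neg p a c (+) area_neg p b q) (area_neg p a q (+) area_neg p b c).
  by apply: gp_area; nondegenerate gS.
move: gq gp'; rewrite /crosses /inside.
rewrite -!(area_negR q) -(area_negR p a) -(area_negR p a c) -(area_negR p b c).
have -> : area_neg p c q = ~~ area_neg c p q by apply: area_negC; nondegenerate gS.
have -> : area_neg p b q = ~~ area_neg b p q by apply: area_negC; nondegenerate gS.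
have -> : area_neg p a q = ~~ area_neg a p q by apply: area_negC; nondegenerate gS.
have -> : area_neg c a p = ~~ area_neg a c p by apply: area_negC; nondegenerate gS.
have -> : area_neg c a q = ~~ area_neg a c q by apply: area_negC; nondegenerate gS.
rewrite !(area_negR _ p q) => gq gp'.

have := planar_checkP (area_neg a b c) (area_neg a b p) (area_neg a b q)
  (area_neg a c p) (area_neg a c q) (area_neg a p q)
  (area_neg b c p) (area_neg b c q) (area_neg b p q) (area_neg c p q).
by rewrite /planar_check gq /= gp' => /eqP.
Qed.

Local Ltac even_sign := rewrite /area_neg /vol_neg; congr (_ < 0);
  rewrite /area /vol /=; ring.
Local Ltac odd_sign gS :=
  rewrite /area_neg /vol_neg -oppr_neg; [congr (_ < 0); rewrite /area /vol /=;
    ring | nondegenerate gS].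

(** A point that runs from p to q starts or stops being below the triangle either by
    passing under a side or by going through the triangle.  Formally, nine of the
    Grassmann-Pluecker relations between the five points and the vertical direction
    exclude all the sign patterns that violate the identity. *)
Lemma overcross_triangle S a b c p q : generic S ->
  {subset [:: a; b; c; p; q] <= S} -> uniq [:: a; b; c; p; q] ->
  (overcross a b p q (+) overcross b c p q (+) overcross c a p q) =
  (below a b c p (+) below a b c q (+) pierces a b c p q).
Proof.
move=> gS sS uS; unpack_distinct sS uS.
have g0 : gp_signs (vol_neg b p a c (+) area_neg b p q)
  (vol_neg b p a q (+) area_neg b p c) (area_neg b p a (+) vol_neg b p c q).
  by apply: gp_vol; nondegenerate gS.
have g1 : gp_signs (vol_neg b q a c (+) area_neg b q p)
  (vol_neg b q a p (+) area_neg b q c) (area_neg b q a (+) vol_neg b q c p).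
  by apply: gp_vol; nondegenerate gS.
have g2 : gp_signs (area_neg b a c (+) area_neg b p q)
  (area_neg b a p (+) area_neg b c q) (area_neg b a q (+) area_neg b c p).
  by apply: gp_area; nondegenerate gS.
have g3 : gp_signs (vol_neg c p a b (+) area_neg c p q)
  (vol_neg c p a q (+) area_neg c p b) (area_neg c p a (+) vol_neg c p b q).
  by apply: gp_vol; nondegenerate gS.
have g4 : gp_signs (vol_neg c q a b (+) area_neg c q p)
  (vol_neg c q a p (+) area_neg c q b) (area_neg c q a (+) vol_neg c q b p).
  by apply: gp_vol; nondegenerate gS.
have g5 : gp_signs (area_neg c a b (+) area_neg c p q)
  (area_neg c a p (+) area_neg c b q) (area_neg c a q (+) area_neg c b p).
  by apply: gp_area; nondegenerate gS.
have g6 : gp_signs (vol_neg p q a b (+) area_neg p q c)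
  (vol_neg p q a c (+) area_neg p q b) (area_neg p q a (+) vol_neg p q b c).
  by apply: gp_vol; nondegenerate gS.
have g7 : gp_signs (area_neg p a b (+) area_neg p c q)
  (area_neg p a c (+) area_neg p b q) (area_neg p a q (+) area_neg p b c).
  by apply: gp_area; nondegenerate gS.
have g8 : gp_signs (area_neg q a b (+) area_neg q c p)
  (area_neg q a c (+) area_neg q b p) (area_neg q a p (+) area_neg q b c).
  by apply: gp_area; nondegenerate gS.
(* Every determinant is put in the order a, b, c, p, q of its arguments. *)
have e_bac : area_neg b a c = ~~ area_neg a b c by odd_sign gS.
have e_bap : area_neg b a p = ~~ area_neg a b p by odd_sign gS.
have e_baq : area_neg b a q = ~~ area_neg a b q by odd_sign gS.
have e_bpa : area_neg b p a = area_neg a b p by even_sign.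
have e_bpac : vol_neg b p a c = ~~ vol_neg a b c p by odd_sign gS.
have e_bpaq : vol_neg b p a q = vol_neg a b p q by even_sign.
have e_bpc : area_neg b p c = ~~ area_neg b c p by odd_sign gS.
have e_bpcq : vol_neg b p c q = ~~ vol_neg b c p q by odd_sign gS.
have e_bqa : area_neg b q a = area_neg a b q by even_sign.
have e_bqac : vol_neg b q a c = ~~ vol_neg a b c q by odd_sign gS.
have e_bqap : vol_neg b q a p = ~~ vol_neg a b p q by odd_sign gS.
have e_bqc : area_neg b q c = ~~ area_neg b c q by odd_sign gS.
have e_bqcp : vol_neg b q c p = vol_neg b c p q by even_sign.
have e_bqp : area_neg b q p = ~~ area_neg b p q by odd_sign gS.
have e_cab : area_neg c a b = area_neg a b c by even_sign.
have e_cap : area_neg c a p = ~~ area_neg a c p by odd_sign gS.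
have e_capq : vol_neg c a p q = ~~ vol_neg a c p q by odd_sign gS.
have e_caq : area_neg c a q = ~~ area_neg a c q by odd_sign gS.
have e_cbp : area_neg c b p = ~~ area_neg b c p by odd_sign gS.
have e_cbq : area_neg c b q = ~~ area_neg b c q by odd_sign gS.
have e_cpa : area_neg c p a = area_neg a c p by even_sign.
have e_cpab : vol_neg c p a b = vol_neg a b c p by even_sign.
have e_cpaq : vol_neg c p a q = vol_neg a c p q by even_sign.
have e_cpb : area_neg c p b = area_neg b c p by even_sign.
have e_cpbq : vol_neg c p b q = vol_neg b c p q by even_sign.
have e_cqa : area_neg c q a = area_neg a c q by even_sign.
have e_cqab : vol_neg c q a b = vol_neg a b c q by even_sign.
have e_cqap : vol_neg c q a p = ~~ vol_neg a c p q by odd_sign gS.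
have e_cqb : area_neg c q b = area_neg b c q by even_sign.
have e_cqbp : vol_neg c q b p = ~~ vol_neg b c p q by odd_sign gS.
have e_cqp : area_neg c q p = ~~ area_neg c p q by odd_sign gS.
have e_pab : area_neg p a b = area_neg a b p by even_sign.
have e_pac : area_neg p a c = area_neg a c p by even_sign.
have e_paq : area_neg p a q = ~~ area_neg a p q by odd_sign gS.
have e_pbc : area_neg p b c = area_neg b c p by even_sign.
have e_pbq : area_neg p b q = ~~ area_neg b p q by odd_sign gS.
have e_pcq : area_neg p c q = ~~ area_neg c p q by odd_sign gS.
have e_pqa : area_neg p q a = area_neg a p q by even_sign.
have e_pqab : vol_neg p q a b = vol_neg a b p q by even_sign.
have e_pqac : vol_neg p q a c = vol_neg a c p q by even_sign.
have e_pqb : area_neg p q b = area_neg b p q by even_sign.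
have e_pqbc : vol_neg p q b c = vol_neg b c p q by even_sign.
have e_pqc : area_neg p q c = area_neg c p q by even_sign.
have e_pqca : vol_neg p q c a = ~~ vol_neg a c p q by odd_sign gS.
have e_qab : area_neg q a b = area_neg a b q by even_sign.
have e_qac : area_neg q a c = area_neg a c q by even_sign.
have e_qap : area_neg q a p = area_neg a p q by even_sign.
have e_qbc : area_neg q b c = area_neg b c q by even_sign.
have e_qbp : area_neg q b p = area_neg b p q by even_sign.
have e_qcp : area_neg q c p = area_neg c p q by even_sign.
move: g0 g1 g2 g3 g4 g5 g6 g7 g8; rewrite /overcross /crosses /below /inside /pierces
  -!andbA.
rewrite ?e_bac ?e_bap ?e_baq ?e_bpa ?e_bpac ?e_bpaq ?e_bpc ?e_bpcq ?e_bqa ?e_bqac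
  ?e_bqap ?e_bqc ?e_bqcp ?e_bqp ?e_cab ?e_cap ?e_capq ?e_caq ?e_cbp ?e_cbq ?e_cpa
  ?e_cpab ?e_cpaq ?e_cpb ?e_cpbq ?e_cqa ?e_cqab ?e_cqap ?e_cqb ?e_cqbp ?e_cqp ?e_pab
  ?e_pac ?e_paq ?e_pbc ?e_pbq ?e_pcq ?e_pqa ?e_pqab ?e_pqac ?e_pqb ?e_pqbc ?e_pqc
  ?e_pqca ?e_qab ?e_qac ?e_qap ?e_qbc ?e_qbp ?e_qcp => g0 g1 g2 g3 g4 g5 g6 g7 g8.
have := spatial_checkP (area_neg a b c) (area_neg a b p) (area_neg a b q)
  (area_neg a c p) (area_neg a c q) (area_neg a p q) (area_neg b c p) (area_neg b c q)
  (area_neg b p q) (area_neg c p q) (vol_neg a b c p) (vol_neg a b c q)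
  (vol_neg a b p q) (vol_neg a c p q) (vol_neg b c p q).
by rewrite /spatial_check g0 g1 g2 g3 g4 g5 g6 g7 g8 => /eqP.
Qed.

End FivePoints.

Section FewPoints.
Variable R : realFieldType.
Local Notation pt := 'rV[R]_3.
Variable (S : seq pt).
Hypothesis gS : generic S.
Implicit Types a b c o p q v w : pt.

Lemma crossesC a b p q : crosses a b p q = crosses p q a b.
Proof. by rewrite /crosses andbC. Qed.

Lemma crosses_swap a b p q : {subset [:: a; b; p; q] <= S} ->
  uniq [:: a; b; p; q] -> crosses b a p q = crosses a b p q.
Proof.
move=> sS uS; unpack_distinct sS uS; rewrite /crosses.
have -> : area_neg b a p = ~~ area_neg a b p by apply: area_negC; nondegenerate gS.
have -> : area_neg b a q = ~~ area_neg a b q by apply: area_negC; nondegenerate gS.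
by rewrite addbN addNb negbK [area_neg p q b (+) _]addbC.
Qed.

(** The four areas satisfy one affine relation, which forces p q to see a and b in
    the order opposite to the one in which a b sees p and q; hence exactly one of the
    two segments is the upper one. *)
Lemma overcross_sym a b p q : {subset [:: a; b; p; q] <= S} ->
  uniq [:: a; b; p; q] -> overcross a b p q (+) overcross p q a b = crosses a b p q.
Proof.
move=> sS uS; unpack_distinct sS uS;
  rewrite /overcross vol_negS [crosses p q a b]crossesC.
case h: (crosses a b p q) => //=.
suff -> : area_neg p q a = ~~ area_neg a b p by case: (vol_neg _ _ _ _);
  case: (area_neg _ _ _).
move: h; rewrite /crosses /area_neg.
have n1 : area a b p != 0 by nondegenerate gS.
have n2 : area a b q != 0 by nondegenerate gS.
have n3 : area p q a != 0 by nondegenerate gS.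
have n4 : area p q b != 0 by nondegenerate gS.
have e : area a b p - area a b q = area p q b - area p q a by rewrite /area; ring.
case: (ltrgtP (area a b p) 0) n1 => //; case: (ltrgtP (area a b q) 0) n2 => //;
case: (ltrgtP (area p q a) 0) n3 => //; case: (ltrgtP (area p q b) 0) n4 => //;
move=> *; lra.
Qed.

Lemma row3P a b : cx a = cx b -> cy a = cy b -> cz a = cz b -> a = b.
Proof.
move=> hx hy hz; apply/rowP => -[[|[|[|//]]] hi].
- by rewrite (bool_irrelevance hi isT).
- by rewrite (bool_irrelevance hi isT).
- by rewrite (bool_irrelevance hi isT).
Qed.

Lemma sum_pos_same (x y z : R) : x != 0 -> y != 0 -> z != 0 ->
  (z < 0) == (x < 0) -> (x < 0) == (y < 0) ->
  [/\ 0 <= x / (x + y + z), 0 <= y / (x + y + z), 0 <= z / (x + y + z) &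
    x + y + z != 0].
Proof.
case: (ltrgtP x 0) => // hx _; case: (ltrgtP y 0) => // hy _;
case: (ltrgtP z 0) => // hz _ _ _.
- have s0 : x + y + z < 0 by lra.
  by split; rewrite ?lt_eqF //; apply: mulr_le0; rewrite ?invr_le0 ltW.
- have s0 : 0 < x + y + z by lra.
  by split; rewrite ?gt_eqF //; apply: divr_ge0; rewrite ltW.
Qed.

(** The volumes spanned by p q and the three sides are proportional to the
    barycentric coordinates of the intersection point, and the volumes of a b c with
    p and q to its coordinates on the segment. *)
Lemma pierces_meet a b c p q : {subset [:: a; b; c; p; q] <= S} ->
  uniq [:: a; b; c; p; q] -> pierces a b c p q ->
  exists t x y z : R, [/\ 0 <= t <= 1, [/\ 0 <= x, 0 <= y & 0 <= z], x + y + z = 1 &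
    (1 - t) *: p + t *: q = x *: a + y *: b + z *: c].
Proof.
move=> sS uS; unpack_distinct sS uS; rewrite /pierces /vol_neg.
have nA : vol a b c p != 0 by nondegenerate gS.
have nB : vol a b c q != 0 by nondegenerate gS.
have nU : vol p q b c != 0 by nondegenerate gS.
have nV : vol p q c a != 0 by nondegenerate gS.
have nW : vol p q a b != 0 by nondegenerate gS.
case/and3P=> hAB h1 h2.
have [x0 y0 z0 s0] := sum_pos_same nU nV nW h1 h2.
set s := _ + _ + _ in x0 y0 z0 s0.
have es : s = vol a b c q - vol a b c p by rewrite /s /vol /=; ring.
exists (- vol a b c p / s), (vol p q b c / s), (vol p q c a / s), (vol p q a b / s).
split.
- rewrite es; move: hAB s0; rewrite es.
  case: (ltrgtP (vol a b c p) 0) nA => // hA _;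
  case: (ltrgtP (vol a b c q) 0) nB => // hB _ _ _.
  + by rewrite divr_ge0 ?ler_pdivrMr; lra.
  + by rewrite -mulrNN -invrN divr_ge0 ?ler_pdivrMr; lra.
- by split.
- by rewrite -!mulrDl divff.
- have e1 : 1 - - vol a b c p / s = vol a b c q / s.
    by apply: (mulIf s0); rewrite mulrBl mul1r !mulfVK // es; ring.
  rewrite e1 [_ / s]mulrC [- _ / s]mulrC ![_ / s]mulrC -!scalerA -!scalerDr.
  congr (_ *: _).
  by apply: row3P; rewrite /vol /cx /cy /cz /= !mxE; ring.
Qed.

(** Inside the angle at o, the side a b separates the points of the triangle from
    those seen from o across that side. *)
Lemma crosses_wedge o w a b : {subset [:: o; w; a; b] <= S} ->
  uniq [:: o; w; a; b] ->
  crosses o w a b (+) inside o a b w = wedge o a b w.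
Proof.
move=> sS uS; unpack_distinct sS uS; rewrite /crosses /inside /wedge (area_negR o a b).
have -> : area_neg o w a = ~~ area_neg o a w by apply: area_negX; nondegenerate gS.
have -> : area_neg o w b = ~~ area_neg o b w by apply: area_negX; nondegenerate gS.
have -> : area_neg b o w = ~~ area_neg o b w by apply: area_negC; nondegenerate gS.
by case: (area_neg o a w); case: (area_neg o b w); case: (area_neg o a b);
  case: (area_neg a b w).
Qed.

(** Going from a to b, one enters or leaves the angle between v and w each time that
    one of its two sides is crossed. *)
Lemma wedge_exchange o a b v w : {subset [:: o; a; b; v; w] <= S} ->
  uniq [:: o; a; b; v; w] ->
  wedge o a b v (+) wedge o a b w = wedge o v w a (+) wedge o v w b.
Proof.
move=> sS uS; unpack_distinct sS uS.
have g : gp_signs (area_neg o a b (+) area_neg o v w)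
  (area_neg o a v (+) area_neg o b w) (area_neg o a w (+) area_neg o b v).
  by apply: gp_area; nondegenerate gS.
move: g; rewrite /wedge /gp_signs.
have -> : area_neg o v b = ~~ area_neg o b v by apply: area_negX; nondegenerate gS.
have -> : area_neg o w b = ~~ area_neg o b w by apply: area_negX; nondegenerate gS.
have -> : area_neg o v a = ~~ area_neg o a v by apply: area_negX; nondegenerate gS.
by case: (area_neg o a b); case: (area_neg o v w); case: (area_neg o a v);
  case: (area_neg o b w);
  case: (area_neg o a w); case: (area_neg o b v).
Qed.

(** If o is inside the triangle x y z, then v is in exactly one of the three angles
    and none of x, y, z is in the opposite angle.  Otherwise exactly one of x, y, z
    lies in the angle of the other two, and v lies in none or in two of the
    angles. *)
Lemma three_wedges o v x y z : {subset [:: o; v; x; y; z] <= S} ->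
  uniq [:: o; v; x; y; z] ->
  (wedge o y z v (+) wedge o y z x) (+) (wedge o z x v (+) wedge o z x y)
    (+) (wedge o x y v (+) wedge o x y z) = true.
Proof.
move=> sS uS; unpack_distinct sS uS.
have g : gp_signs (area_neg o v x (+) area_neg o y z)
  (area_neg o v y (+) area_neg o x z) (area_neg o v z (+) area_neg o x y).
  by apply: gp_area; nondegenerate gS.
move: g; rewrite /wedge /gp_signs.
have -> : area_neg o x v = ~~ area_neg o v x by apply: area_negX; nondegenerate gS.
have -> : area_neg o y v = ~~ area_neg o v y by apply: area_negX; nondegenerate gS.
have -> : area_neg o z v = ~~ area_neg o v z by apply: area_negX; nondegenerate gS.
have -> : area_neg o y x = ~~ area_neg o x y by apply: area_negX; nondegenerate gS.
have -> : area_neg o z x = ~~ area_neg o x z by apply: area_negX; nondegenerate gS.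
have -> : area_neg o z y = ~~ area_neg o y z by apply: area_negX; nondegenerate gS.
by case: (area_neg o v x); case: (area_neg o v y); case: (area_neg o v z);
  case: (area_neg o x y);
  case: (area_neg o x z); case: (area_neg o y z).
Qed.

End FewPoints.

(** * Chains of segments modulo 2 *)

Local Notation "\xor_ ( i <- r ) F" := (\big[addb/false]_(i <- r) F)
  (at level 36, F at level 36, i, r at level 50, format "\xor_ ( i  <-  r )  F").
Local Notation "\xor_ i F" := (\big[addb/false]_i F)
  (at level 36, F at level 36, i at level 0, format "\xor_ i  F").
Local Notation "\xor_ ( i | P ) F" := (\big[addb/false]_(i | P) F)
  (at level 36, F at level 36, i at level 50, format "\xor_ ( i  |  P )  F").

Local Ltac mem_list := rewrite /= !inE !eqxx ?orbT.

Section Chains.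
Variable R : realFieldType.
Local Notation pt := 'rV[R]_3.
Local Notation chain := (seq (pt * pt)).
Implicit Types (a b c o p q v w : pt) (e f : pt * pt) (E F : chain) (g : pt -> bool).

Definition crossings E F : bool := \xor_(e <- E) \xor_(f <- F) crosses e.1 e.2 f.1 f.2.
Definition linking E F : bool := \xor_(e <- E) \xor_(f <- F) overcross e.1 e.2 f.1 f.2.
(** The boundary of a chain is given by its pairing with the functions on points:
    [spans E u v] says that it is u + v, and [closed_chain E] that it vanishes. *)
Definition boundary E g : bool := \xor_(e <- E) (g e.1 (+) g e.2).
Definition spans E u v : Prop := forall g, boundary E g = g u (+) g v.
Definition closed_chain E : Prop := forall g, boundary E g = false.

(** The multiplicity at p of the cone from o over the projection of E. *)
Definition wind o E p : bool := \xor_(e <- E) inside o e.1 e.2 p.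
Definition ray o F p : bool := \xor_(f <- F) crosses o p f.1 f.2.

Variable S : seq pt.
Hypothesis gS : generic S.

Definition distinct_in (s : seq pt) := uniq s && all (fun x => x \in S) s.

Lemma distinct_in_sub s t : distinct_in s -> uniq t -> all (mem s) t ->
  uniq t /\ {subset t <= S}.
Proof.
move=> /andP[_ /allP sS] ut /allP st; split=> // x xt.
exact: sS (st _ xt).
Qed.

Lemma distinct_in_all s t : distinct_in s -> uniq t -> all (mem s) t ->
  distinct_in t.
Proof.
by move=> d ut st; have [_ sS] := distinct_in_sub d ut st; apply/andP; split=> //;
  apply/allP.
Qed.

(** The point o is an auxiliary cone vertex. *)
Definition apart o E F : Prop := forall e f, e \in E -> f \in F ->
  distinct_in [:: o; e.1; e.2; f.1; f.2].

(** Modulo the boundary of the triangle o a b, the segment a b is the sum of the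
    spokes o a and o b.  The spokes contribute the first term and, by
    [crosses_triangle], the triangles contribute the second one. *)
Lemma crossings_cone o E F : apart o E F ->
  crossings E F = boundary E (ray o F) (+) boundary F (wind o E).
Proof.
move=> ap; rewrite /crossings /boundary.
have -> : \xor_(e <- E) (ray o F e.1 (+) ray o F e.2) = 
  \xor_(e <- E) \xor_(f <- F) (crosses o e.1 f.1 f.2 (+) crosses o e.2 f.1 f.2).
  by apply: eq_bigr => e _; rewrite big_split.
have -> : \xor_(f <- F) (wind o E f.1 (+) wind o E f.2) = 
  \xor_(e <- E) \xor_(f <- F) (inside o e.1 e.2 f.1 (+) inside o e.1 e.2 f.2).
  by rewrite exchange_big; apply: eq_bigr => e _; rewrite big_split.
rewrite -big_split; apply: eq_big_seq => e eE /=.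
rewrite -big_split; apply: eq_big_seq => f fF /=.
have d := ap _ _ eE fF; have /andP[u /allP s] := d.
have [] := distinct_in_sub (t := [:: o; e.2; f.1; f.2]) d; first by distinct_from u.
  by mem_list.
move=> u' s'; rewrite -(crosses_triangle gS s u) (crosses_swap gS s' u').
by case: (crosses _ _ _ _); case: (crosses _ _ _ _); case: (crosses _ _ _ _).
Qed.

Lemma crossings_closed o E F : apart o E F -> closed_chain E -> closed_chain F ->
  crossings E F = false.
Proof. by move=> ap cE cF; rewrite (crossings_cone ap) cE cF. Qed.

Lemma linking_sym o E F : apart o E F ->
  linking E F (+) linking F E = crossings E F.
Proof.
move=> ap; rewrite /linking [X in _ (+) X]exchange_big -big_split.
apply: eq_big_seq => e eE /=; rewrite -big_split; apply: eq_big_seq => f fF /=.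
have d := ap _ _ eE fF; have /andP[u _] := d.
have [] := distinct_in_sub (t := [:: e.1; e.2; f.1; f.2]) d; first by distinct_from u.
  by mem_list.
by move=> u' s'; apply: (overcross_sym gS).
Qed.

Lemma linking_catl E1 E2 F : linking (E1 ++ E2) F = linking E1 F (+) linking E2 F.
Proof. by rewrite /linking big_cat. Qed.
Lemma linking_catr E F1 F2 : linking E (F1 ++ F2) = linking E F1 (+) linking E F2.
Proof. by rewrite /linking -big_split; apply: eq_bigr => e _; rewrite big_cat. Qed.

Lemma xor_ord3 (h : 'I_3 -> bool) :
  \xor_i h i = h ord0 (+) h (lift ord0 ord0) (+) h ord_max.
Proof.
rewrite !big_ord_recl big_ord0 /= addbF addbA.
by congr (_ (+) _ (+) h _); apply/val_inj.
Qed.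

Lemma xor_const2 (c : bool) (j : 'I_3) : \xor_(l | l != j) c = false.
Proof. by rewrite big_mkcond xor_ord3; case: j => [[|[|[|]]]] //= _; case: c. Qed.

Lemma xor_ne_l (h : 'I_3 -> bool) : \xor_j \xor_(l | l != j) h j = false.
Proof. by rewrite big1 // => j _; rewrite xor_const2. Qed.

Lemma xor_neC (h : 'I_3 -> 'I_3 -> bool) :
  \xor_j \xor_(l | l != j) h j l = \xor_j \xor_(l | l != j) h l j.
Proof.
rewrite (exchange_big_dep xpredT) //=.
by apply: eq_bigr => j _; apply: eq_bigl => l; rewrite eq_sym.
Qed.

Lemma xor_ne_split (h1 h2 : 'I_3 -> 'I_3 -> bool) :
  \xor_j \xor_(l | l != j) (h1 j l (+) h2 j l) =
  (\xor_j \xor_(l | l != j) h1 j l) (+) (\xor_j \xor_(l | l != j) h2 j l).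
Proof. by rewrite -big_split; apply: eq_bigr => j _; rewrite big_split. Qed.

(** * The parity of the crossings of K_{3,3} *)

Section K33.
Variables (o : pt) (v w : 'I_3 -> pt) (E : 'I_3 -> 'I_3 -> chain).
Hypothesis spE : forall i j, spans (E i j) (v i) (w j).
Hypothesis apE : forall i j k l, i != k -> j != l ->
  apart o (E i j) ((v k, w l) :: E k l).
Hypothesis apV : forall i, 
  distinct_in [:: o; v i; w ord0; w (lift ord0 ord0); w ord_max].

Definition crossings_between i k :=
  \xor_j \xor_(l | l != j) crossings (E i j) (E k l).

Definition ray_part k := \xor_j \xor_(l | l != j) ray o (E k l) (w j).
Definition wind_part i := \xor_j \xor_(l | l != j) wind o (E i j) (w l).

(** In [crossings_cone], the terms that mention v depend on only one of the two
    distinct indices j and l; each of them occurs twice and disappears. *)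
Lemma crossings_betweenE i k : i != k ->
  crossings_between i k = ray_part k (+) wind_part i.
Proof.
move=> ik; rewrite /crossings_between.
transitivity (\xor_j \xor_(l | l != j) ((ray o (E k l) (v i) (+) wind o (E i j) (v k))
   (+) (ray o (E k l) (w j) (+) wind o (E i j) (w l)))).
  apply: eq_bigr => j _; apply: eq_bigr => l lj.
  rewrite (@crossings_cone o).
    by rewrite spE spE addbACA.
  have jl : j != l by rewrite eq_sym.
  by move=> e f eE fE; apply: (apE ik jl eE); rewrite in_cons fE orbT.
rewrite !xor_ne_split (xor_neC (fun j l => ray o (E k l) (v i))).
by rewrite !xor_ne_l.
Qed.

(** By [crosses_wedge], an edge E k j and a vertex w l contribute the number of times
    that the edge turns past w l around o.  By [wedge_exchange], the sum of these
    numbers over the two values of l depends only on the ends v k and w j of the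
    edge, and [three_wedges] adds up the three results. *)
Lemma star_parity k : ray_part k (+) wind_part k = true.
Proof.
rewrite /ray_part xor_neC /wind_part -big_split /=.
pose turns j p := \xor_(e <- E k j) wedge o e.1 e.2 p.
have far j l e : l != j -> e \in E k j -> 
    uniq [:: o; e.1; e.2; w l] /\ {subset [:: o; e.1; e.2; w l] <= S}.
(* Any other vertex v k' gives an edge E k' l disjoint from E k j, and hence the
     general position of w l with respect to E k j. *)
  move=> lj eE; pose k' : 'I_3 := if k == ord0 then ord_max else ord0.
  have kk : k != k' by rewrite /k'; case: (eqVneq k ord0) => [->|].
  have := apE kk (j := j) (l := l); rewrite eq_sym => /(_ lj e (v k', w l) eE).
  rewrite inE eqxx => /(_ isT) d; have /andP[u _] := d.
  by apply: (distinct_in_sub d); [distinct_from u | mem_list].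
transitivity (\xor_j \xor_(l | l != j) turns j (w l)).
  apply: eq_bigr => j _; rewrite -big_split; apply: eq_bigr => l lj /=.
  rewrite /ray /wind -big_split; apply: eq_big_seq => e eE /=.
  have [u s] := far _ _ _ lj eE.
  apply: (crosses_wedge gS); last by distinct_from u.
  by move=> x xs; apply: s; move: xs; rewrite !inE => /or4P[] ->; rewrite ?orbT.
have two j l m : l != j -> m != j -> w l != w m ->
    turns j (w l) (+) turns j (w m) = wedge o (w l) (w m) (v k) (+) wedge o (w l) (w m)
      (w j).
  move=> lj mj lm; rewrite -(spE k j (wedge o (w l) (w m))) /turns -big_split.
  apply: eq_big_seq => e eE /=.
  have [u s] := far _ _ _ lj eE.
  have [u' s'] := far _ _ _ mj eE.
  apply: (wedge_exchange gS).
    apply/allP; rewrite /= andbT; apply/and5P.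
    by split; first [by apply: s; mem_list | by apply: s'; mem_list].
  have u2 : uniq [:: o; e.1; e.2; w l] && uniq [:: o; e.1; e.2; w m] by rewrite u u'.
  by distinct_from u2.
have d := apV k; have /andP[u /allP s] := d.
rewrite xor_ord3 !(big_mkcond (fun l => l != _)) !xor_ord3 /=.
have [n01 n02 n12] : [/\ w ord0 != w (lift ord0 ord0), w ord0 != w ord_max &
    w (lift ord0 ord0) != w ord_max] by split; distinct_from u.
have n20 : w ord_max != w ord0 by rewrite eq_sym.
rewrite !addbF [X in _ (+) X (+) _]addbC !two ?(three_wedges gS s u) //.
Qed.

(** The van Kampen obstruction: in the sum over the three pairs of indices, the
    parts that belong to the first and to the last vertex occur twice. *)
Lemma K33_crossings :
  crossings_between ord0 (lift ord0 ord0) (+) crossings_between ord0 ord_max (+)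
  crossings_between (lift ord0 ord0) ord_max = true.
Proof.
rewrite !crossings_betweenE // -(star_parity (lift ord0 ord0)).
by case: (ray_part _); case: (ray_part _); case: (wind_part _); case: (wind_part _).
Qed.

Section Apex.
Variables A B : 'I_3 -> chain.

Definition triangle i j : chain := A i ++ E i j ++ B j.
Definition square i j : chain :=
  \big[cat/[::]]_(k | k != i) \big[cat/[::]]_(l | l != j) E k l.

Lemma linking_square F i j :
  linking F (square i j) = \xor_(k | k != i) \xor_(l | l != j) linking F (E k l).
Proof.
have m : {morph linking F : F1 F2 / F1 ++ F2 >-> F1 (+) F2} := @linking_catr F.
have l0 : linking F [::] = false.
  by rewrite /linking big1 // => e _; rewrite big_nil.
rewrite (big_morph _ m l0); apply: eq_bigr => k _.
by rewrite (big_morph _ m l0).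
Qed.

(** A segment of A i or B j and a segment of E k l occur together for two values of
    the free index.  Two segments of E i j and E k l occur together once in each
    order, and [linking_sym] turns their contributions into crossings. *)
Lemma K331_linking : \xor_i \xor_j linking (triangle i j) (square i j) = true.
Proof.
have split3 i j : linking (triangle i j) (square i j) =
    \xor_(k | k != i) \xor_(l | l != j)
      (linking (A i) (E k l) (+) linking (E i j) (E k l) (+) linking (B j) (E k l)).
  rewrite linking_square; apply: eq_bigr => k _; apply: eq_bigr => l _.
  by rewrite !linking_catl addbA.
pose L i k := \xor_j \xor_(l | l != j) linking (E i j) (E k l).
transitivity (\xor_i \xor_(k | k != i) L i k).
  transitivity (\xor_i \xor_(k | k != i) \xor_j \xor_(l | l != j)
      (linking (A i) (E k l) (+) linking (E i j) (E k l) (+) linking (B j) (E k l))).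
    apply: eq_bigr => i _; rewrite (eq_bigr _ (fun j _ => split3 i j)).
    exact: exchange_big.
  rewrite (_ : \xor_i _ = \xor_i \xor_(k | k != i)
     (L i k (+) \xor_j \xor_(l | l != j) linking (B j) (E k l))).
    rewrite xor_ne_split (xor_neC (fun i k => \xor_j \xor_(l | l != j) linking (B j)
      (E k l))).
    by rewrite xor_ne_l addbF.
  apply: eq_bigr => i _; apply: eq_bigr => k _.
  rewrite !xor_ne_split (xor_neC (fun j l => linking (A i) (E k l))).
  by rewrite xor_ne_l.
have sym i k : i != k -> L i k (+) L k i = crossings_between i k.
  move=> ik; rewrite /L [X in _ (+) X]xor_neC -xor_ne_split.
  apply: eq_bigr => j _; apply: eq_bigr => l lj; apply: (@linking_sym o).
  have jl : j != l by rewrite eq_sym.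
  by move=> e f eE fE; apply: (apE ik jl eE); rewrite in_cons fE orbT.
rewrite -[RHS]K33_crossings -(sym ord0 (lift ord0 ord0)) // -(sym ord0 ord_max) //.
rewrite -(sym (lift ord0 ord0) ord_max) //.
rewrite xor_ord3 !(big_mkcond (fun l => l != _)) !xor_ord3 /= ?addbF.
by case: (L _ _); case: (L _ _); case: (L _ _); case: (L _ _); case: (L _ _);
  case: (L _ _).
Qed.

End Apex.
End K33.
End Chains.

(** * General position *)

Section Cofinite.
Variable R : realFieldType.

(** Being nonzero at the values of a fixed nonzero polynomial: such conditions are
    stable under finite conjunctions and hold at arbitrarily small arguments. *)
Definition cofinitely (Q : R -> Prop) : Prop :=
  exists2 p : {poly R}, p != 0 & forall x, p.[x] != 0 -> Q x.

Lemma cofinitely_poly (p : {poly R}) : p != 0 -> cofinitely (fun x => p.[x] != 0).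
Proof. by exists p. Qed.

Lemma cofinitely_all (T : eqType) (s : seq T) (Q : T -> R -> Prop) :
  (forall i, i \in s -> cofinitely (Q i)) ->
  cofinitely (fun x => forall i, i \in s -> Q i x).
Proof.
elim: s => [|i s IH] h; first by exists 1 => [|x _ i]; rewrite ?oner_eq0.
have [|p p0 hp] := IH; first by move=> j js; apply: h; rewrite inE js orbT.
have [q q0 hq] := h i (mem_head _ _).
exists (q * p) => [|x]; first by rewrite mulf_neq0.
rewrite hornerM mulf_eq0 negb_or => /andP[qx px] j.
by rewrite inE => /predU1P[->|js]; [apply: hq | apply: hp].
Qed.

Lemma cofinitely_weak (Q Q' : R -> Prop) : (forall x, Q x -> Q' x) -> cofinitely Q ->
  cofinitely Q'.
Proof. by move=> h [p p0 hp]; exists p => // x /hp /h. Qed.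

Lemma cofinitely_and (Q Q' : R -> Prop) : cofinitely Q -> cofinitely Q' ->
  cofinitely (fun x => Q x /\ Q' x).
Proof.
move=> [p p0 hp] [q q0 hq]; exists (p * q) => [|x]; first by rewrite mulf_neq0.
by rewrite hornerM mulf_eq0 negb_or => /andP[/hp ? /hq].
Qed.

Lemma cofinitely_small (Q : R -> Prop) (d : R) : 0 < d -> cofinitely Q ->
  exists2 x, 0 < x < d & Q x.
Proof.
move=> d0 [p p0 hp]; pose s := [seq d / i.+2%:R | i <- iota 0 (size p)].
have us : uniq s.
  rewrite map_inj_uniq ?iota_uniq // => i j /(mulfI (lt0r_neq0 d0)) /invr_inj /eqP.
  by rewrite eqr_nat => /eqP[].
have : ~~ all (root p) s.
  apply/negP => h; have := max_poly_roots p0 h us.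
  by rewrite size_map size_iota ltnn.
rewrite -has_predC => /hasP[x /mapP[i _ ->]] /= r; exists (d / i.+2%:R).
  by rewrite divr_gt0 ?ltr0n //= ltr_pdivrMr ?ltr0n // -[ltLHS]mulr1 ltr_pM2l // ltr1n.
exact/hp.
Qed.

End Cofinite.

Section GeneralPosition.
Variable R : realType.
Local Notation pt := 'rV[R]_3.
Implicit Types (a b c d p q : pt) (S : seq pt).

Lemma coord_le_norm n (a : 'rV[R]_n) i : `|a ord0 i| <= `|a|.
Proof.
rewrite [leRHS]/Num.norm /= mx_normrE.
by apply/bigmax_geP; right => /=; exists (ord0, i).
Qed.

Lemma norm_lt_coord n (a : 'rV[R]_n) (e : R) : 0 < e -> 
  (forall i, `|a ord0 i| < e) -> `|a| < e.
Proof.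
move=> e0 h; rewrite [ltLHS]/Num.norm /= mx_normrE.
by apply/bigmax_ltP; split=> // -[i j] _ /=; rewrite ord1.
Qed.

Definition moment (g : pt) (x : R) : pt := g + \row_(i < 3) x ^+ i.+1.

Lemma cx_moment g x : cx (moment g x) = cx g + x.
Proof. by rewrite /cx !mxE expr1. Qed.
Lemma cy_moment g x : cy (moment g x) = cy g + x ^+ 2.
Proof. by rewrite /cy !mxE. Qed.
Lemma cz_moment g x : cz (moment g x) = cz g + x ^+ 3.
Proof. by rewrite /cz !mxE. Qed.

Lemma cofinitely_cubic (c0 c1 c2 c3 : R) : [|| c1 != 0, c2 != 0 | c3 != 0] ->
  cofinitely (fun x => c0 + c1 * x + c2 * x ^+ 2 + c3 * x ^+ 3 != 0).
Proof.
move=> h; pose p := Poly [:: c0; c1; c2; c3].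
have p0 : p != 0.
  apply: contraTneq h => e; have c k : p`_k = 0 by rewrite e coef0.
  have := c 1%N; have := c 2%N; have := c 3%N; rewrite !coef_Poly /= => -> -> ->.
  by rewrite eqxx.
apply: cofinitely_weak (cofinitely_poly p0) => x; rewrite horner_Poly /=.
by congr (_ != 0); ring.
Qed.

(** Move along the moment curve through g.  Each degeneracy to be avoided is the
    vanishing of a polynomial in the parameter, and this polynomial is nonzero: the
    coefficient of x, x^2 or x^3 is 1, a difference of distinct abscissae, or the
    area of three distinct points. *)
Lemma generic_near S g (e : R) : generic S -> 0 < e ->
  exists p, [/\ `|p - g| < e, p \notin S & generic (p :: S)].
Proof.
move=> [S2 S3 S4] e0.
have c2 : cofinitely (fun x => forall a, a \in S -> cx (moment g x) != cx a).
  apply: cofinitely_all => a aS.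
  have h : [|| (1 : R) != 0, (0 : R) != 0 | (0 : R) != 0] by rewrite oner_eq0.
  apply: cofinitely_weak (cofinitely_cubic (cx g - cx a) h) => x.
  by rewrite cx_moment; apply: contraNneq => h'; apply/eqP; lra.
have c3 : cofinitely (fun x => forall a, a \in S -> forall b, b \in S -> 
    a != b -> area a b (moment g x) != 0).
  apply: cofinitely_all => a aS; apply: cofinitely_all => b bS.
  have [ab|ab] := eqVneq a b; first by exists 1 => //; rewrite oner_eq0.
  have h : [|| - (cy b - cy a) != 0, cx b - cx a != 0 | (0 : R) != 0].
    by rewrite (subr_eq0 (cx b)) S2 ?orbT 1?eq_sym.
  apply: cofinitely_weak (cofinitely_cubic (area a b g) h) => x + _.
  by congr (is_true (_ != 0)); rewrite /area cx_moment cy_moment; ring.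
have c4 : cofinitely (fun x => forall a, a \in S -> forall b, b \in S -> 
    forall c, c \in S -> uniq [:: a; b; c] -> vol a b c (moment g x) != 0).
  apply: cofinitely_all => a aS; apply: cofinitely_all => b bS.
  apply: cofinitely_all => c cS.
  have [u|] := boolP (uniq [:: a; b; c]); last by exists 1 => //; rewrite oner_eq0.
  pose k1 := (cy b - cy a) * (cz c - cz a) - (cz b - cz a) * (cy c - cy a).
  pose k2 := (cz b - cz a) * (cx c - cx a) - (cx b - cx a) * (cz c - cz a).
  have h : [|| k1 != 0, k2 != 0 | area a b c != 0] by rewrite S3 ?orbT.
  apply: cofinitely_weak (cofinitely_cubic (vol a b c g) h) => x + _.
  congr (is_true (_ != 0)).
  by rewrite /vol /area /k1 /k2 cx_moment cy_moment cz_moment /=; ring.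
have m0 : 0 < Num.min 1 e by rewrite lt_min ltr01.
have [x /andP[x0]] := cofinitely_small m0 (cofinitely_and c2 (cofinitely_and c3 c4)).
rewrite lt_min => /andP[x1 xe] [h2 [h3 h4]].
exists (moment g x); split.
- rewrite /moment addrC addKr; apply: norm_lt_coord => // i.
  rewrite mxE ger0_norm ?exprn_ge0 ?ltW //; apply: le_lt_trans xe.
  by rewrite exprS; apply: ler_piMr; [exact: ltW | apply: exprn_ile1; exact: ltW].
- by apply/negP => /h2; rewrite eqxx.
- split.
  + move=> a b; rewrite !inE => /predU1P[->|aS] /predU1P[->|bS]; rewrite ?eqxx // => ab.
    * exact: h2.
    * by rewrite eq_sym; exact: h2.
    * exact: S2.
  + move=> a b c; rewrite 3!inE => /predU1P[->|aS] /predU1P[->|bS] /predU1P[->|cS];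
      rewrite /= => u; try by move: u; rewrite ?inE ?eqxx ?orbT ?andbF.
    * by rewrite -areaR; apply: h3 => //; distinct_from u.
    * by rewrite areaR; apply: h3 => //; distinct_from u.
    * by apply: h3 => //; distinct_from u.
    * by apply: S3 => //; distinct_from u.
  + move=> a b c; rewrite 3!inE => /predU1P[->|aS] /predU1P[->|bS] /predU1P[->|cS] d;
      rewrite in_cons => /predU1P[->|dS] /= u; try by move: u;
        rewrite ?inE ?eqxx ?orbT ?andbF.
    * rewrite (_ : vol _ b c d = - vol b c d (moment g x)); last by rewrite /vol /=;
      ring.
      by rewrite oppr_eq0; apply: h4 => //; distinct_from u.
    * rewrite (_ : vol a _ c d = vol a c d (moment g x)); last by rewrite /vol /=; ring.
      by apply: h4 => //; distinct_from u.
    * rewrite (_ : vol a b _ d = - vol a b d (moment g x)); last by rewrite /vol /=;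
      ring.
      by rewrite oppr_eq0; apply: h4 => //; distinct_from u.
    * by apply: h4 => //; distinct_from u.
    * by apply: S4 => //; distinct_from u.
Qed.

(** The new points carry indices, because the given positions may coincide. *)
Lemma generic_extend S (I : eqType) (L : seq I) (t : I -> pt) (e : R) :
  generic S -> 0 < e ->
  exists phi : I -> pt, [/\ forall i, i \in L -> `|phi i - t i| < e,
    generic (map phi L ++ S), {in L &, injective phi} &
    forall i, i \in L -> phi i \notin S].
Proof.
move=> gS e0; elim: L => [|i L [phi [near_t gen inj notS]]]; first by exists t.
have [iL|iL] := boolP (i \in L).
  have sL j : (j \in i :: L) = (j \in L) by rewrite inE; case: eqP => // ->.
  exists phi; split.
  - by move=> j; rewrite sL; exact: near_t.
  - by apply: generic_sub gen => p; rewrite inE => /predU1P[->|//];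
    rewrite mem_cat map_f.
  - by move=> j k; rewrite !sL; exact: inj.
  - by move=> j; rewrite sL; exact: notS.
have [p [pt_ pS gp_]] := generic_near (t i) gen e0.
have ne j : j \in L -> (j == i) = false by move=> jL; apply: contraNF iL => /eqP <-.
have pL j : j \in L -> phi j != p.
  by move=> jL; apply: contraNneq pS => <-; rewrite mem_cat map_f.
exists (fun j => if j == i then p else phi j); split.
- by move=> j; rewrite inE; case: eqP => [->|_] //=; exact: near_t.
- rewrite /= eqxx; have -> // : [seq (if j == i then p else phi j) | j <- L] = map phi
  L.
  by apply/eq_in_map => j /ne ->.
- move=> j k; rewrite !inE; case: eqP => [->|_] /=; case: eqP => [->|_] //=.
  + by move=> _ kL /eqP; rewrite eq_sym (negPf (pL _ kL)).
  + by move=> jL _ /eqP; rewrite (negPf (pL _ jL)).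
  + exact: inj.
- move=> j; rewrite inE; case: eqP => [->|_] //=; last exact: notS.
  by move=> _; apply: contra pS; rewrite mem_cat orbC => ->.
Qed.
End GeneralPosition.

(** * Uniform scales on compact sets *)

Section Metric.
Variable R : realType.

Lemma continuous_epsP (V W : normedModType R) (f : V -> W) x :
  {for x, continuous f} <->
  forall e : R, 0 < e -> exists2 d : R, 0 < d & forall y, `|x - y| < d -> `|f x - f y| <
    e.
Proof.
split=> [/cvgrPdist_lt h e e0|h].
  have /nbhs_ballP[d d0 hd] := h _ e0.
  by exists d => // y xy; apply: hd; rewrite -ball_normE.
apply/cvgrPdist_lt => e e0; have [d d0 hd] := h _ e0.
by apply/nbhs_ballP; exists d => //= y; rewrite -ball_normE; apply: hd.
Qed.

(** The common pattern of the Lebesgue number, of the distance between a compact and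
    a closed set, and of uniform continuity: what holds at all small scales near
    each point holds at one scale everywhere. *)
Lemma compact_scale (V : normedModType R) (K : set V) (P : R -> V -> Prop) :
  compact K ->
  (forall x, K x -> exists2 e : R, 0 < e &
     forall y d, `|x - y| < e -> 0 < d < e -> P d y) ->
  exists2 e : R, 0 < e & forall y, K y -> P e y.
Proof.
move=> /compact_near_coveringP cK h.
have := cK R (0 : R)^'+ (fun d y => P d y) _.
case.
- move=> x /h[e e0 he].
  exists (ball x e, [set d | 0 < d < e]) => /=.
    split; first exact: nbhsx_ballx.
    near=> d; apply/andP; split; near: d; [exact: nbhs_right_gt|exact: nbhs_right_lt].
  by move=> [y d] /= [xy de]; apply: he => //; move: xy; rewrite -ball_normE.
move=> e /= e0 he.
exists (e / 2); first by rewrite divr_gt0.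
apply: he => /=; last by rewrite divr_gt0.
by rewrite sub0r normrN ger0_norm ?divr_ge0 ?ltW // gtr_pMr // invf_lt1 // ltr1n.
Unshelve. all: by end_near.
Qed.

Lemma compact_open_scale (V : normedModType R) (K O : set V) :
  compact K -> open O -> K `<=` O ->
  exists2 e : R, 0 < e & forall x y, K x -> `|x - y| < e -> O y.
Proof.
move=> cK oO KO.
have [|e e0 he] := compact_scale (P := fun e x => forall y, `|x - y| < e -> O y) cK.
  move=> x /KO Ox.
  have /nbhs_ballP[e e0 he] : nbhs x O by apply: open_nbhs_nbhs.
  have e20 : 0 < e / 2 by rewrite divr_gt0.
  exists (e / 2) => // y d xy /andP[d0 de] z yz.
  apply: he; rewrite -ball_normE /ball_ /=.
  by have := ler_distD y x z; lra.
by exists e => // x y Kx; apply: he.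
Qed.

Lemma compact_uniform (V W : normedModType R) (K : set V) (f : V -> W) :
  compact K -> {within K, continuous f} -> forall e : R, 0 < e ->
  exists2 d : R, 0 < d &
    forall x y, K x -> K y -> `|x - y| < d -> `|f x - f y| < e.
Proof.
move=> cK /subspace_continuousP cf e e0.
have near_x x : K x -> exists2 d : R, 0 < d &
    forall y, K y -> `|x - y| < d -> `|f x - f y| < e / 2.
  move=> Kx; have e20 : 0 < e / 2 by rewrite divr_gt0.
  have /cvgrPdist_lt/(_ _ e20) := cf x Kx.
  rewrite near_withinE => /nbhs_ballP[d d0 hd].
  by exists d => // y Ky xy; apply: hd => //; rewrite -ball_normE.
have [|d d0 hd] := compact_scale
    (P := fun d x => forall y, K x -> K y -> `|x - y| < d -> `|f x - f y| < e) cK.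
  move=> x Kx; have [d d0 hd] := near_x x Kx.
  have d20 : 0 < d / 2 by rewrite divr_gt0.
  exists (d / 2) => // y c xy /andP[c0 cd] z Ky Kz yz.
  have h1 : `|f x - f y| < e / 2 by apply: hd => //; lra.
  have h2 : `|f x - f z| < e / 2.
    by apply: hd => //; have := ler_distD y x z; lra.
  by have := ler_distD (f x) (f y) (f z); rewrite (distrC (f y) (f x)); lra.
by exists d => // x y Kx Ky; apply: hd.
Qed.

End Metric.

(** * Linking parity under small moves *)

Section Homotopy.
Variable R : realType.
Local Notation pt := 'rV[R]_3.
Local Notation chain := (seq (pt * pt)).
Implicit Types (a b c o p q x : pt) (E F : chain) (S : seq pt).

Definition avoids F x (r : R) : Prop := forall f t, f \in F -> 0 <= t <= 1 ->
  r <= `|x - ((1 - t) *: f.1 + t *: f.2)|.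

Lemma overcross_swap S a b p q : generic S -> {subset [:: a; b; p; q] <= S} ->
  uniq [:: a; b; p; q] -> overcross b a p q = overcross a b p q.
Proof.
move=> gS sS uS; rewrite /overcross (crosses_swap gS) //.
have [_ S3 S4] := gS.
rewrite (@vol_negC _ a b) ?(@area_negC _ a b); first by case: (vol_neg _ _ _ _);
  case: (area_neg _ _ _).
  by apply: S3; first [by apply: sS; mem_list | distinct_from uS].
by apply: S4 => //; apply: sS; mem_list.
Qed.

(** A ball is convex, so the triangle stays inside it. *)
Lemma not_pierces S a b c p q x (r : R) : generic S ->
  {subset [:: a; b; c; p; q] <= S} -> uniq [:: a; b; c; p; q] ->
  `|x - a| < r -> `|x - b| < r -> `|x - c| < r -> avoids [:: (p, q)] x r ->
  pierces a b c p q = false.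
Proof.
move=> gS sS uS xa xb xc av; apply/negP => /(pierces_meet gS sS uS).
move=> [t [u [v [w [t01 [u0 v0 w0] uvw e]]]]].
have := av (p, q) t (mem_head _ _) t01; rewrite /= e leNgt => /negP; apply.
have -> : x - (u *: a + v *: b + w *: c) = u *: (x - a) + v *: (x - b) + w *: (x - c).
  rewrite !scalerBr -{1}[x]scale1r -uvw !scalerDl !opprD.
  by rewrite addrACA [X in X + _]addrACA.
apply: le_lt_trans (ler_normD _ _) _;
  apply: le_lt_trans (lerD (ler_normD _ _) (lexx _)) _.
rewrite !normrZ !ger0_norm //.
have h1 : u * `|x - a| <= u * r by rewrite ler_wpM2l // ltW.
have h2 : v * `|x - b| <= v * r by rewrite ler_wpM2l // ltW.
have h3 : w * `|x - c| <= w * r by rewrite ler_wpM2l // ltW.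
have [w1|w1] := ltP 0 w.
  have h4 : w * `|x - c| < w * r by rewrite ltr_pM2l.
  have : (u + v + w) * r = r by rewrite uvw mul1r.
  rewrite !mulrDl; lra.
have w00 : w = 0 by apply/le_anti; rewrite w1 w0.
have [v1|v1] := ltP 0 v.
  have h4 : v * `|x - b| < v * r by rewrite ltr_pM2l.
  have : (u + v + w) * r = r by rewrite uvw mul1r.
  rewrite !mulrDl; lra.
have v00 : v = 0 by apply/le_anti; rewrite v1 v0.
have -> : u = 1 by move: uvw; rewrite v00 w00 !addr0.
by rewrite v00 w00 !mul0r mul1r !addr0.
Qed.

End Homotopy.

Lemma xor_eq (a b : bool) : a (+) b = false -> a = b.
Proof. by case: a; case: b. Qed.

Section Contraction.
Variable R : realType.
Local Notation pt := 'rV[R]_3.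
Local Notation chain := (seq (pt * pt)).
Implicit Types (a b c o p q x : pt) (E F : chain) (S T : seq pt) (phi psi : pt -> pt).

Definition map_chain (I : Type) (phi : I -> pt) (E : seq (I * I)) : chain :=
  [seq (phi e.1, phi e.2) | e <- E].

(** The triangle a b c is not pierced by F, so by [overcross_triangle] its sides
    pass over a segment of F once for each end of the segment that is below the
    triangle; as F is closed, these ends cancel in pairs. *)
Lemma linking_triangle S a b c F x (r : R) : generic S ->
  (forall f, f \in F -> distinct_in S [:: a; b; c; f.1; f.2]) -> closed_chain F ->
  `|x - a| < r -> `|x - b| < r -> `|x - c| < r -> avoids F x r ->
  linking [:: (a, b)] F (+) linking [:: (b, c)] F = linking [:: (a, c)] F.
Proof.
move=> gS dF cF xa xb xc av.
apply: xor_eq.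
rewrite /linking !big_seq1 -!big_split -[RHS](cF (below a b c)).
apply: eq_big_seq => f fF /=; have d := dF f fF; have /andP[u /allP s] := d.
have [|//|u' s'] := distinct_in_sub (t := [:: a; c; f.1; f.2]) d;
  first by distinct_from u.
  by mem_list.
rewrite -(overcross_swap gS s' u') (overcross_triangle gS s u).
rewrite (not_pierces gS s u xa xb xc) ?addbF // => g t.
by rewrite inE => /eqP -> /=; exact: av.
Qed.

(** The quadrilateral between an edge and its new position is cut into two
    triangles.  The sides that join old to new vertices cancel, as E is closed. *)
Lemma linking_homotopy S phi psi E F (r : R) : generic S ->
  (forall e f, e \in E -> f \in F ->
    distinct_in S [:: phi e.1; phi e.2; psi e.1; psi e.2; f.1; f.2]) ->
  closed_chain E -> closed_chain F ->
  (forall e, e \in E -> exists x, [/\ `|x - phi e.1| < r, `|x - phi e.2| < r,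
     `|x - psi e.1| < r, `|x - psi e.2| < r & avoids F x r]) ->
  linking (map_chain phi E) F = linking (map_chain psi E) F.
Proof.
move=> gS dEF cE cF near_E; apply: xor_eq.
rewrite -(cE (fun a => linking [:: (phi a, psi a)] F)) /boundary.
rewrite /linking !big_map -big_split; apply: eq_big_seq => -[a b] eE /=.
have [x [xa xb xa' xb' av]] := near_E _ eE.
rewrite !big_seq1 /=.
pose lk p q := linking [:: (p, q)] F.
have lkE p q : \xor_(f <- F) overcross p q f.1 f.2 = lk p q.
  by rewrite /lk /linking big_seq1.
rewrite !lkE.
have h1 : lk (phi a) (phi b) (+) lk (phi b) (psi b) = lk (phi a) (psi b).
  apply: (linking_triangle gS _ cF xa xb xb' av) => f fF.
  have d := dEF _ _ eE fF; have /andP[u _] := d.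
  by apply: (distinct_in_all d); [distinct_from u | mem_list].
have h2 : lk (phi a) (psi a) (+) lk (psi a) (psi b) = lk (phi a) (psi b).
  apply: (linking_triangle gS _ cF xa xa' xb' av) => f fF.
  have d := dEF _ _ eE fF; have /andP[u _] := d.
  by apply: (distinct_in_all d); [distinct_from u | mem_list].
move: h1; rewrite -h2.
by case: (lk _ _); case: (lk _ _); case: (lk _ _); case: (lk _ _).
Qed.

Definition vertices E : seq pt := unzip1 E ++ unzip2 E.
Lemma vertices1 E e : e \in E -> e.1 \in vertices E.
Proof. by move=> eE; rewrite mem_cat map_f. Qed.
Lemma vertices2 E e : e \in E -> e.2 \in vertices E.
Proof. by move=> eE; rewrite mem_cat orbC map_f. Qed.
Lemma verticesP E a : a \in vertices E -> exists2 e, e \in E & a = e.1 \/ a = e.2.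
Proof.
by rewrite mem_cat => /orP[] /mapP[e eE ->]; exists e => //; [left | right].
Qed.

(** The maps h j contract the vertices of E to c in n small steps.  They need not put
    them in general position, so at each step the actual positions phi are new
    generic points within d of the ideal ones.  The four vertices of a moving edge
    then stay within 4 d of h j of one of its ends: d for the perturbation of each
    vertex, d for the step and d for the length of the edge. *)
Lemma contractible_linking S E F (h : nat -> pt -> pt) n c (d : R) :
  generic S ->
  (forall e f, e \in E -> f \in F -> distinct_in S [:: e.1; e.2; f.1; f.2]) ->
  closed_chain E -> closed_chain F -> 0 < d ->
  (forall a, a \in vertices E -> h 0%N a = a) ->
  (forall a, a \in vertices E -> h n a = c) ->
  (forall j a, a \in vertices E -> `|h j a - h j.+1 a| < d) ->
  (forall j e, e \in E -> `|h j e.1 - h j e.2| < d) ->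
  (forall j a, a \in vertices E -> avoids F (h j a) (4%:R * d)) ->
  linking E F = false.
Proof.
move=> gS dEF cE cF d0 h0 hn hS hE av.
pose L := vertices E.
have layer j : exists T phi, [/\ generic T, {subset S <= T},
    forall e f, e \in E -> f \in F -> distinct_in T [:: phi e.1; phi e.2; f.1; f.2],
    forall a, a \in L -> `|phi a - h j a| < d &
    linking (map_chain phi E) F = linking E F].
  elim: j => [|j [T [phi [gT sST dT nT lT]]]].
    exists S, id; split=> //; first by move=> a aL; rewrite h0 // subrr normr0.
    by congr (linking _ F); rewrite -[RHS]map_id; apply: eq_map => -[].
  have [psi [npsi gpsi ipsi psiT]] := generic_extend L (h j.+1) gT d0.
  have dpsi e f : e \in E -> f \in F -> distinct_in (map psi L ++ T)
      [:: phi e.1; phi e.2; psi e.1; psi e.2; f.1; f.2].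
    move=> eE fF; have e1 := vertices1 eE; have e2 := vertices2 eE.
    have e12 : e.1 != e.2 by have /andP[u _] := dEF e f eE fF; distinct_from u.
    have /andP[uT /allP sT] := dT e f eE fF.
    have ne a p : a \in L -> p \in [:: phi e.1; phi e.2; f.1; f.2] -> psi a != p.
      by move=> aL /sT pT; apply: contraNneq (psiT a aL) => ->.
    have psi12 : psi e.1 != psi e.2 by apply: contra e12 => /eqP /ipsi ->.
    have n1 : all (fun p => psi e.1 != p) [:: phi e.1; phi e.2; f.1; f.2].
      by apply/allP => p; apply: ne.
    have n2 : all (fun p => psi e.2 != p) [:: phi e.1; phi e.2; f.1; f.2].
      by apply/allP => p; apply: ne.
    apply/andP; split.
      have /and3P u3 := And3 uT n1 n2.
      by distinct_from u3.
    apply/allP => p; rewrite mem_cat => ps.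
    have : (p \in [:: psi e.1; psi e.2]) || (p \in [:: phi e.1; phi e.2; f.1; f.2]).
      by move: ps; rewrite !inE; do ?case/orP => [->|]; rewrite ?orbT // => ->;
        rewrite ?orbT.
    case/orP => [|/sT -> //]; last by rewrite orbT.
    by rewrite !inE => /orP[] /eqP ->; rewrite map_f.
  exists (map psi L ++ T), psi; split=> //.
  - by move=> p pS; rewrite mem_cat orbC sST.
  - by move=> e f eE fF; have D := dpsi e f eE fF; have /andP[u _] := D;
    apply: (distinct_in_all D); [distinct_from u | mem_list].
  - rewrite -lT; symmetry.
    apply: (linking_homotopy (S := map psi L ++ T) (r := 4%:R * d)) => //.
    move=> e eE; exists (h j e.1).
      have e1 := vertices1 eE; have e2 := vertices2 eE.
      have p1 := nT _ e1; have p2 := nT _ e2.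
      have q1 := npsi _ e1; have q2 := npsi _ e2.
      have s1 := hS j _ e1; have s2 := hS j _ e2; have s12 := hE j _ eE.
      rewrite ![`|phi _ - _|]distrC ![`|psi _ - _|]distrC in p1 p2 q1 q2.
      split; last exact: av.
      * lra.
      * by have := ler_distD (h j e.2) (h j e.1) (phi e.2); lra.
      * by have := ler_distD (h j.+1 e.1) (h j e.1) (psi e.1); lra.
      * have := ler_distD (h j e.2) (h j e.1) (psi e.2).
        by have := ler_distD (h j.+1 e.2) (h j e.2) (psi e.2); lra.
have [T [phi [gT sST dT nT <-]]] := layer n.
have [q [qc qT gq]] := generic_near c gT d0.
rewrite /linking big_map -[RHS](cE (fun a => linking [:: (q, phi a)] F)).
apply: eq_big_seq => e eE /=.
have e1 := vertices1 eE; have e2 := vertices2 eE.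
have near_c a : a \in L -> `|c - phi a| < 4%:R * d.
  by move=> aL; rewrite distrC -(hn a aL); have := nT a aL; lra.
have lq := linking_triangle gq _ cF _ (near_c _ e1) (near_c _ e2).
have {}lq := lq q; rewrite -lq; first 1 last.
- move=> f fF; have /andP[u /allP s] := dT e f eE fF.
  have nq p : p \in [:: phi e.1; phi e.2; f.1; f.2] -> q != p.
    by move=> /s; apply: contraTneq => <-.
  apply/andP; split; last first.
    by apply/allP => p; rewrite inE => /predU1P[->|/s pT]; rewrite inE ?eqxx // pT orbT.
  have /andP u2 : uniq [:: phi e.1; phi e.2; f.1; f.2] /\
     all (fun p => q != p) [:: phi e.1; phi e.2; f.1; f.2].
    by split=> //; apply/allP.
  by distinct_from u2.
- by rewrite distrC; lra.
- by rewrite -(hn _ e1); apply: av.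
by rewrite /linking !big_seq1 addKb.
Qed.

End Contraction.

(** * Cycles separated by a sphere have even linking *)

Section Sphere.
Variable R : realType.
Local Notation pt := 'rV[R]_3.
Local Notation chain := (seq (pt * pt)).
Implicit Types (a b c o p q x : pt) (E F : chain) (S T : seq pt) (A B : set pt).

Lemma sqnorm3 x : sqnorm x = cx x ^+ 2 + cy x ^+ 2 + cz x ^+ 2.
Proof.
rewrite /sqnorm !big_ord_recl big_ord0 addr0 addrA /cx /cy /cz.
by congr (x _ _ ^+ 2 + x _ _ ^+ 2 + x _ _ ^+ 2); apply/val_inj.
Qed.

Lemma continuous_sqnorm : continuous (@sqnorm R 3).
Proof.
have -> : @sqnorm R 3 = fun x => cx x ^+ 2 + cy x ^+ 2 + cz x ^+ 2.
  by apply/funext => x; rewrite sqnorm3.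
have cc i : continuous (fun x : pt => x ord0 i ^+ 2).
  move=> x; apply: (continuous_comp (f := fun y : pt => y ord0 i)
    (g := @GRing.exp R ^~ 2%N)).
    exact: coord_continuous.
  exact: exprn_continuous.
by move=> x; exact: (continuousD (continuousD (cc _ x) (cc _ x)) (cc _ x)).
Qed.

Lemma sqnormZ n (t : R) (x : 'rV[R]_n) : sqnorm (t *: x) = t ^+ 2 * sqnorm x.
Proof. by rewrite /sqnorm mulr_sumr; apply: eq_bigr => i _; rewrite mxE exprMn. Qed.

Lemma sqnorm_ge0 n (x : 'rV[R]_n) : 0 <= sqnorm x.
Proof. by apply: sumr_ge0 => i _; rewrite sqr_ge0. Qed.

Lemma norm_le_sqnorm n (x : 'rV[R]_n) : sqnorm x <= 1 -> `|x| <= 1.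
Proof.
move=> h; rewrite [leLHS]/Num.norm /= mx_normrE.
apply/bigmax_leP; split=> // -[i j] _ /=; rewrite ord1.
rewrite -(ler_pXn2r (n := 2)) ?nnegrE // expr1n real_normK ?num_real //.
apply: le_trans h; rewrite /sqnorm (bigD1 j) //= lerDl.
by apply: sumr_ge0 => k _; rewrite sqr_ge0.
Qed.

Lemma compact_ball (r : R) : r <= 1 -> compact [set x : pt | sqnorm x <= r].
Proof.
move=> r1; apply: bounded_closed_compact.
  exists 1; split=> // M M1 x /= xr; apply: le_trans (ltW M1).
  by apply: norm_le_sqnorm; apply: le_trans r1.
apply: (@closed_comp _ _ (@sqnorm R 3) [set y | y <= r]).
  by move=> x _; apply: continuous_sqnorm.
exact: closed_le.
Qed.

(** Polygons of this kind approximate a curve A; that their edges are short is part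
    of the definition, since close vertices alone would allow large jumps. *)
Definition near_chain A (e : R) E : Prop := forall s, s \in E ->
  [/\ `|s.1 - s.2| < e, exists2 a, A a & `|a - s.1| < e & exists2 a, A a & `|a - s.2| <
    e].

Lemma near_chainW A (d e : R) E : d <= e -> near_chain A d E -> near_chain A e E.
Proof.
move=> de h s /h[s12 [a Aa as1] [b Ab bs2]].
by split; [|exists a|exists b] => //; apply: lt_le_trans de.
Qed.

(** In the coordinates given by the inverse g of k, the inner curve lies in a ball of
    radius less than 1 and is contracted by x -> t g x.  All the scales come from
    compactness: the approximations of A stay in the image K of the smaller ball, K
    is at distance d from B, and k and g are uniformly continuous. *)
Lemma inside_outside_linking (k : pt -> pt) A B : homeomorphism k ->
  compact A -> compact B ->
  A `<=` k @` [set x | sqnorm x < 1] -> B `<=` k @` [set x | 1 < sqnorm x] ->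
  exists2 e : R, 0 < e & forall S E F, generic S ->
    (forall s f, s \in E -> f \in F -> distinct_in S [:: s.1; s.2; f.1; f.2]) ->
    closed_chain E -> closed_chain F -> near_chain A e E -> near_chain B e F ->
    linking E F = false.
Proof.
move=> [g [kg gk ck cg]] cA cB Ain Bout.
pose N x := sqnorm (g x).
have cN : continuous N by move=> x; apply: continuous_comp;
  [exact: cg | exact: continuous_sqnorm].
have [r r0 Ar] : exists2 r : R, 0 < r & forall a, A a -> N a < 1 - r.
  apply: (compact_scale (P := fun r x => N x < 1 - r) cA) => x /Ain[y /= y1 <-].
  have m0 : 0 < (1 - sqnorm y) / 2 by rewrite divr_gt0 // subr_gt0.
  have [d d0 hd] := (continuous_epsP N (k y)).1 (cN _) _ m0.
  exists (Num.min d ((1 - sqnorm y) / 2)); first by rewrite lt_min d0.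
  move=> z c; rewrite !lt_min => /andP[yz _] /and3P[c0 _ c1].
  have := hd z yz; rewrite /N kg ltr_norml => /andP[]; lra.
pose K := k @` [set x | sqnorm x <= 1 - r].
have KE x : N x <= 1 - r -> K x by move=> h; exists (g x).
have cK : compact K.
  apply: continuous_compact; first exact: continuous_subspaceT.
  by apply: compact_ball; lra.
have oN : open [set x | N x < 1 - r].
  apply: (@open_comp _ _ N [set y | y < 1 - r]); first by move=> x _; apply: cN.
  exact: open_lt.
have [e1 e10 he1] := compact_open_scale cA oN Ar.
have clB : open (~` B) by apply: closed_openC; apply: compact_closed cB;
  exact: norm_hausdorff.
have KB : K `<=` ~` B.
  move=> x [y /= yr <-] /Bout[z /= z1 /(congr1 g)]; rewrite !kg => yz; subst z; lra.
have [d d0 hd] := compact_open_scale cK clB KB.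
(* Four times d / 8 for [contractible_linking] leave the other half of d to the
   approximation of B: twice the d / 4 below. *)
have d80 : 0 < d / 8%:R by rewrite divr_gt0.
have [e2 e20 he2] := compact_uniform (compact_ball (lexx 1)) (continuous_subspaceT ck)
  d80.
have [e3 e30 he3] := compact_uniform cK (continuous_subspaceT cg) e20.
exists (Num.min e1 (Num.min e3 (d / 4%:R))).
  by rewrite !lt_min e10 e30 divr_gt0.
move=> S E F gS dEF cE cF nE nF.
pose n := (Num.bound e2^-1).+1.
have nP : n%:R^-1 < e2.
  rewrite invf_plt ?posrE ?ltr0n //; apply: lt_trans (archi_boundP _) _.
    by rewrite invr_ge0 ltW.
  by rewrite ltr_nat.
pose t (j : nat) : R := (n - j)%:R / n%:R.
have t01 j : 0 <= t j <= 1.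
  by rewrite /t divr_ge0 //= ler_pdivrMr ?ltr0n // mul1r ler_nat leq_subr.
have n_gt0 : 0 < n%:R :> R by rewrite ltr0n.
have tS j : `|t j - t j.+1| <= n%:R^-1.
  rewrite /t -mulrBl normrM [`|n%:R^-1|]ger0_norm ?invr_ge0 //.
  rewrite ler_piMl ?invr_ge0 // -natrB ?leq_sub2l // normr_nat.
  by rewrite (ler_nat _ _ 1) /n; lia.
have NZ j x : N x <= 1 - r -> sqnorm (t j *: g x) <= 1 - r.
  have /andP[t0 t1] := t01 j.
  rewrite sqnormZ; apply: le_trans; rewrite ler_piMl ?sqnorm_ge0 //.
  by rewrite exprn_ile1.
have NZ1 j x : N x <= 1 - r -> sqnorm (t j *: g x) <= 1.
  by move=> /(NZ j) h; apply: le_trans h _; lra.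
have inN a : a \in vertices E -> N a <= 1 - r.
  move=> /verticesP[s /nE[_ [p Ap ps1] [q Aq qs2]] [->|->]]; apply: ltW.
    by apply: (he1 p) => //; apply: lt_le_trans ps1 _; rewrite ge_min lexx.
  by apply: (he1 q) => //; apply: lt_le_trans qs2 _; rewrite ge_min lexx.
apply: (@contractible_linking R S E F (fun j x => k (t j *: g x)) n (k 0) (d / 8%:R)) =>
  //.
- by move=> a _; rewrite /t subn0 divff ?gt_eqF // scale1r gk.
- by move=> a _; rewrite /t subnn mul0r scale0r.
- move=> j a /inN aN; apply: he2; try exact: NZ1.
  rewrite -scalerBl normrZ; apply: le_lt_trans nP; apply: le_trans (tS j).
  by rewrite ler_piMr // norm_le_sqnorm //; apply: le_trans aN _; lra.
- move=> j s sE; apply: he2; [exact/NZ1/inN/vertices1 | exact/NZ1/inN/vertices2 |].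
  rewrite -scalerBr normrZ; have /andP[t0 t1] := t01 j.
  rewrite ger0_norm //; apply: le_lt_trans (_ : `|g s.1 - g s.2| < _);
    first by rewrite ler_piMl.
  apply: he3; [exact/KE/inN/vertices1 | exact/KE/inN/vertices2 |].
  have [s12 _ _] := nE s sE; apply: lt_le_trans s12 _.
  by rewrite !ge_min lexx !orbT.
- move=> j a /inN aN f u fF /andP[u0 u1]; rewrite leNgt; apply/negP => close.
  have [f12 [b Bb bf] _] := nF f fF.
  move: f12 bf; rewrite !lt_min => /and3P[_ _ f12] /and3P[_ _ bf].
  have Kx : K (k (t j *: g a)) by apply: KE; rewrite /N kg; exact: NZ.
  apply: (hd _ b Kx) => //.
  set y := (1 - u) *: f.1 + u *: f.2 in close.
  have h1 := ler_distD y (k (t j *: g a)) b.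
  have h2 := ler_distD f.1 y b.
  have h3 : `|y - f.1| <= `|f.1 - f.2|.
    have -> : y - f.1 = u *: (f.2 - f.1).
      by rewrite /y scalerBl scale1r scalerBr addrAC [_ - u *: _ - _]addrAC subrr add0r
        addrC.
    by rewrite normrZ ger0_norm // [X in _ <= X]distrC ler_piMl.
  by move: bf; rewrite distrC => bf; lra.
Qed.

Lemma split_linking A B : split_by_sphere A B -> compact A -> compact B ->
  exists2 e : R, 0 < e & forall S o E F, generic S -> apart S o E F ->
    closed_chain E -> closed_chain F -> near_chain A e E -> near_chain B e F ->
    linking E F = false.
Proof.
move=> [k [hk AB]] cA cB.
have apartW S o E F : apart S o E F -> forall s f, s \in E -> f \in F ->
    distinct_in S [:: s.1; s.2; f.1; f.2].
  move=> ap s f sE fF; have d := ap s f sE fF; have /andP[u _] := d.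
  by apply: (distinct_in_all d); [distinct_from u | mem_list].
case: AB => -[hA hB].
  have [e e0 he] := inside_outside_linking hk cA cB hA hB.
  by exists e => // S o E F gS /apartW; apply: he.
have [e e0 he] := inside_outside_linking hk cB cA hB hA.
exists e => // S o E F gS ap cE cF nE nF.
have := linking_sym gS ap; rewrite (crossings_closed gS ap cE cF).
rewrite (he S F E gS) ?addbF // => f s fF sE.
have d := ap s f sE fF; have /andP[u _] := d.
by apply: (distinct_in_all d); [distinct_from u | mem_list].
Qed.

End Sphere.

(** * Cycles of a graph as sets of edges *)

Section Cycles.
Variable G : sgraph.
Implicit Types (c : seq G) (C : {set {set G}}) (u v x y : G).

Definition cycle_edges c : {set {set G}} := [set [set x; next c x] | x in c]%SET.

Lemma cover_cycle_edges c x : x \in finset.cover (cycle_edges c) -> x \in c.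
Proof.
move=> /bigcupP[B /imsetP[y yc ->]]; rewrite !inE => /orP[] /eqP -> //.
by rewrite mem_next.
Qed.

Lemma cycle_edge_adj c u v : ucycle (@adj G) c ->
  [set u; v]%SET \in cycle_edges c -> adj u v.
Proof.
move=> /andP[cc _] /imsetP[x xc e].
have a := next_cycle cc xc.
have xn : x != next c x by apply: contraTneq a => <-; rewrite adj_irr.
have hu : u \in [set x; next c x]%SET by rewrite -e !inE eqxx.
have hv : v \in [set x; next c x]%SET by rewrite -e !inE eqxx orbT.
have hx : x \in [set u; v]%SET by rewrite e !inE eqxx.
have hn : next c x \in [set u; v]%SET by rewrite e !inE eqxx orbT.
move: hu hv hx hn; rewrite !inE => /orP[] /eqP -> /orP[] /eqP -> //.
- by move=> _; rewrite orbb eq_sym (negPf xn).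
- by rewrite adj_sym.
- by rewrite orbb (negPf xn).
Qed.

Lemma cycle_edges3 x y z : uniq [:: x; y; z] ->
  [/\ [set x; y]%SET \in cycle_edges [:: x; y; z],
      [set y; z]%SET \in cycle_edges [:: x; y; z] &
      [set z; x]%SET \in cycle_edges [:: x; y; z]].
Proof.
move=> u; have [xy xz yz] : [/\ y != x, z != x & z != y] by split; distinct_from u.
split; apply/imsetP.
- by exists x; rewrite ?inE ?eqxx // /next /= eqxx.
- by exists y; rewrite ?inE ?eqxx ?orbT // /next /= (negPf xy) eqxx.
- by exists z; rewrite ?inE ?eqxx ?orbT // /next /= (negPf xz) (negPf yz) eqxx.
Qed.

Lemma cycle_edges4 x y z t : uniq [:: x; y; z; t] ->
  [/\ [set x; y]%SET \in cycle_edges [:: x; y; z; t],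
      [set y; z]%SET \in cycle_edges [:: x; y; z; t],
      [set z; t]%SET \in cycle_edges [:: x; y; z; t] &
      [set t; x]%SET \in cycle_edges [:: x; y; z; t]].
Proof.
move=> u; have [xy xz xt] : [/\ y != x, z != x & t != x] by split; distinct_from u.
have [yz yt zt] : [/\ z != y, t != y & t != z] by split; distinct_from u.
split; apply/imsetP.
- by exists x; rewrite ?inE ?eqxx // /next /= eqxx.
- by exists y; rewrite ?inE ?eqxx ?orbT // /next /= (negPf xy) eqxx.
- by exists z; rewrite ?inE ?eqxx ?orbT // /next /= (negPf xz) (negPf yz) eqxx.
- exists t; rewrite ?inE ?eqxx ?orbT // /next /=.
  by rewrite (negPf xt) (negPf yt) (negPf zt) eqxx.
Qed.

End Cycles.

(** * Sampling the edges of an embedded graph *)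

Section Samples.
Variables (R : realType) (G : sgraph) (f : 'rV[R]_#|G| -> 'rV[R]_3).
Hypothesis cf : {within @realization R G, continuous f}.
Implicit Types (u v x y : G).

Lemma compact_finite_union (T : topologicalType) (I : finType) (P : pred I)
  (F : I -> set T) :
  (forall i, P i -> compact (F i)) -> compact [set x | exists2 i, P i & F i x].
Proof.
move=> h; rewrite (_ : [set x | _] = \big[setU/set0]_(i | P i) F i).
  exact: bigsetU_compact.
rewrite -bigcup_seq_cond; apply/seteqP; split=> x.
  by move=> [i Pi Fi]; exists i => //=; rewrite mem_index_enum.
by move=> [i /= /andP[_ Pi] Fi]; exists i.
Qed.

Lemma compact_segment n (a b : 'rV[R]_n) : compact (segment a b).
Proof.
apply: continuous_compact; last exact: segment_compact.
have c1 : continuous (fun t : R => (1 - t) *: a).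
  by move=> t; apply: cvgZr_tmp; apply: cvgB; [exact: cvg_cst | exact: cvg_id].
have c2 : continuous (fun t : R => t *: b).
  by move=> t; apply: cvgZr_tmp; exact: cvg_id.
by apply: continuous_subspaceT => t; exact: (continuousD (c1 t) (c2 t)).
Qed.

Lemma edge_segment_sub u v : adj u v -> @edge_segment R G u v `<=` @realization R G.
Proof. by move=> uv x xs; exists u, v; rewrite uv orbT. Qed.

Lemma compact_realization : compact (@realization R G).
Proof.
rewrite (_ : @realization R G = [set x | exists2 e : G * G, (e.1 == e.2) || adj e.1 e.2
   & @edge_segment R G e.1 e.2 x]).
  by apply: compact_finite_union => e _; exact: compact_segment.
apply/seteqP; split=> x; first by move=> [u [v [h1 h2]]]; exists (u, v).
by move=> [[u v] /= h1 h2]; exists u, v.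
Qed.

Lemma compact_cycle_image c : ucycle (@adj G) c -> compact
  (cycle_image f (cycle_edges c)).
Proof.
move=> cc; rewrite (_ : cycle_image f _ = [set x | exists2 e : G * G,
   [set e.1; e.2]%SET \in cycle_edges c & (f @` @edge_segment R G e.1 e.2) x]).
  apply: compact_finite_union => -[u v] /= /(cycle_edge_adj cc) uv.
  apply: continuous_compact; last exact: compact_segment.
  exact: continuous_subspaceW (edge_segment_sub uv) cf.
apply/seteqP; split=> x; first by move=> [u [v [h1 h2]]]; exists (u, v).
by move=> [[u v] /= h1 h2]; exists u, v.
Qed.

(** The index of the k-th of the n + 1 vertices that subdivide the edge from u to v.
    The ends of the edge get an index that does not depend on the edge, so that
    edges share the indices of their common ends and no others. *)
Definition node n u v k : G * G * nat :=
  if k == 0%N then (u, u, 0%N) else if k == n then (v, v, 0%N) else (u, v, k).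

Definition sample n (i : G * G * nat) : 'rV[R]_3 :=
  f ((1 - i.2%:R / n%:R) *: vertex_point R i.1.1 + (i.2%:R / n%:R) *: vertex_point R
    i.1.2).

Definition edge_path n u v : seq ((G * G * nat) * (G * G * nat)) :=
  [seq (node n u v k, node n u v k.+1) | k <- iota 0 n].

Definition all_nodes n : seq (G * G * nat) :=
  [seq (p, k) | p <- enum {: G * G}, k <- iota 0 n].

Lemma sample_node n u v k : (0 < n)%N -> sample n (node n u v k) =
  f ((1 - k%:R / n%:R) *: vertex_point R u + (k%:R / n%:R) *: vertex_point R v).
Proof.
move=> n0; rewrite /sample /node; case: eqP => [->|_] /=.
  by rewrite mul0r subr0 !scale0r.
case: eqP => [->|_] //=.
by rewrite mul0r subr0 !scale0r addr0 divff ?pnatr_eq0 -?lt0n // subrr scale0r add0r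
  scale1r.
Qed.

Lemma node_all n u v k : (k <= n)%N -> (0 < n)%N -> node n u v k \in all_nodes n.
Proof.
move=> kn n0; apply/allpairsP; rewrite /node; case: eqP => [_|/eqP k0].
  by exists ((u, u), 0%N); rewrite mem_enum mem_iota.
case: eqP => [_|/eqP kn']; first by exists ((v, v), 0%N); rewrite mem_enum mem_iota.
by exists ((u, v), k); rewrite mem_enum mem_iota /= add0n ltn_neqAle kn' kn.
Qed.

Lemma node_neq n u v k : u != v -> node n u v k != node n u v k.+1.
Proof.
move=> uv; have vu : v != u by rewrite eq_sym.
rewrite /node /=; case: (eqVneq k 0%N) => [->|_].
  by case: (eqVneq 1%N n) => _; rewrite !xpair_eqE (negPf uv) ?andbF.
case: (eqVneq k n) => [->|_]; first by rewrite gtn_eqF // !xpair_eqE (negPf vu).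
case: (eqVneq k.+1 n) => _; first by rewrite !xpair_eqE (negPf uv) ?andbF.
by rewrite !xpair_eqE ltn_eqF ?ltnSn ?andbF.
Qed.

Lemma node_fst n u v k : (node n u v k).1.1 \in [:: u; v].
Proof.
by rewrite /node; case: eqP => _; [|case: eqP => _]; rewrite !inE eqxx ?orbT.
Qed.

Lemma sample_step (e : R) : 0 < e -> exists2 n, (0 < n)%N &
  forall u v k, adj u v -> (k < n)%N ->
    `|sample n (node n u v k) - sample n (node n u v k.+1)| < e.
Proof.
move=> e0; have [d d0 hd] := compact_uniform compact_realization cf e0.
have [N [N0 hN]] : exists N, (0 < N)%N /\ forall u v : G, 
    N%:R^-1 * `|vertex_point R u - vertex_point R v| < d.
  pose M : R := \sum_(p : G * G) `|vertex_point R p.1 - vertex_point R p.2|.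
  have M0 : 0 <= M by apply: sumr_ge0.
  exists (Num.bound (M / d)).+1; split=> // u v.
  have hM : `|vertex_point R u - vertex_point R v| <= M.
    by rewrite /M (bigD1 (u, v)) //= lerDl sumr_ge0.
  have hb : M / d < (Num.bound (M / d)).+1%:R.
    apply: lt_trans (archi_boundP _) _; first by rewrite divr_ge0 // ltW.
    by rewrite ltr_nat.
  rewrite mulrC ltr_pdivrMr ?ltr0n //; apply: le_lt_trans hM _.
  by move: hb; rewrite ltr_pdivrMr // mulrC.
exists N => // u v k uv kN; rewrite !sample_node //.
have in_edge j : (j <= N)%N -> realization
    ((1 - j%:R / N%:R) *: vertex_point R u + (j%:R / N%:R) *: vertex_point R v).
  move=> jN; apply: (edge_segment_sub uv); exists (j%:R / N%:R) => //=.
  by rewrite in_itv /= divr_ge0 //= ler_pdivrMr ?ltr0n // mul1r ler_nat.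
apply: hd; [exact/in_edge/ltnW | exact: in_edge |].
set a := vertex_point R u; set b := vertex_point R v.
have -> : (1 - k%:R / N%:R) *: a + (k%:R / N%:R) *: b -
   ((1 - k.+1%:R / N%:R) *: a + (k.+1%:R / N%:R) *: b) = N%:R^-1 *: (a - b).
  rewrite -[k.+1]addn1 natrD mulrDl div1r.
  by apply/rowP => i; rewrite !mxE; ring.
by rewrite normrZ ger0_norm ?invr_ge0 //; exact: hN.
Qed.

End Samples.

(** * Every embedding of K_{3,3,1} has a link *)

Lemma xor_telescope (h : nat -> bool) n :
  \xor_(k <- iota 0 n) (h k (+) h k.+1) = h 0%N (+) h n.
Proof.
elim: n => [|n IH]; first by rewrite big_nil addbb.
by rewrite -addn1 iotaD big_cat IH /= big_seq1 add0n addn1 addbA addbK.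
Qed.

Lemma mem_big_cat (T : eqType) (I : finType) (P : pred I) (F : I -> seq T) x :
  x \in \big[cat/[::]]_(i | P i) F i -> exists2 i, P i & x \in F i.
Proof.
elim/big_rec: _ => // i s Pi IH; rewrite mem_cat => /orP[xF|/IH //].
by exists i.
Qed.

Lemma near_chain_cat (R : realType) A (e : R) E F : near_chain A e E ->
  near_chain A e F -> near_chain A e (E ++ F).
Proof. by move=> nE nF s; rewrite mem_cat => /orP[/nE|/nF]. Qed.

Lemma boundary_cat (R : realType) (E F : seq ('rV[R]_3 * 'rV[R]_3)) g :
  boundary (E ++ F) g = boundary E g (+) boundary F g.
Proof. by rewrite /boundary big_cat. Qed.

Section LowerBound.
Variables (R : realType) (G : sgraph) (f : 'rV[R]_#|G| -> 'rV[R]_3).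
Hypothesis cf : {within @realization R G, continuous f}.
Variables (z : G) (v w : 'I_3 -> G).
Hypotheses (inj_v : injective v) (inj_w : injective w).
Hypotheses (zv : forall i, adj z (v i)) (zw : forall j, adj z (w j)).
Hypothesis (vw : forall i j, adj (v i) (w j)).

Let neq_zv i : z != v i.
Proof. by apply: contraTneq (zv i) => <-; rewrite adj_irr. Qed.
Let neq_zw j : z != w j.
Proof. by apply: contraTneq (zw j) => <-; rewrite adj_irr. Qed.
Let neq_vw i j : v i != w j.
Proof. by apply: contraTneq (vw i j) => ->; rewrite adj_irr. Qed.
Let neq_v i k : i != k -> v i != v k.
Proof. by apply: contra => /eqP /inj_v ->. Qed.
Let neq_w j l : j != l -> w j != w l.
Proof. by apply: contra => /eqP /inj_w ->. Qed.

Definition tri_cycle i j : seq G := [:: z; v i; w j].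
Definition quad_cycle (i j : 'I_3) : seq G :=
  [:: v (i + 1); w (j + 1); v (i + 1 + 1); w (j + 1 + 1)].

Lemma ord3_next (i : 'I_3) : [/\ i + 1 != i, i + 1 + 1 != i, i + 1 + 1 != i + 1 &
  forall k, k != i -> k = i + 1 \/ k = i + 1 + 1].
Proof.
split; try by case: i => [[|[|[|]]]].
move=> k ki; suff /orP[/eqP|/eqP] : (k == i + 1) || (k == i + 1 + 1) by [left|right].
by move: ki; case: i => [[|[|[|]]]] // ?; case: k => [[|[|[|]]]].
Qed.

Lemma cycle_tri i j : ucycle (@adj G) (tri_cycle i j).
Proof.
rewrite /ucycle /= zv vw [adj _ z]adj_sym zw /= !inE.
by rewrite negb_or neq_zv neq_zw neq_vw.
Qed.

Lemma cycle_quad i j : ucycle (@adj G) (quad_cycle i j).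
Proof.
have [_ _ i21 _] := ord3_next i; have [_ _ j21 _] := ord3_next j.
rewrite /ucycle /= !vw ![adj (w _) _]adj_sym !vw /= !inE !negb_or.
by rewrite ![w _ == v _]eq_sym !neq_vw !(eq_sym (v (i + 1))) !(eq_sym (w (j + 1))) neq_v
  // neq_w.
Qed.

Lemma quad_edges i j k l : k != i -> l != j ->
  [set v k; w l]%SET \in cycle_edges (quad_cycle i j).
Proof.
have [_ _ _ hi] := ord3_next i; have [_ _ _ hj] := ord3_next j.
have /andP[_ u] := cycle_quad i j; have [e1 e2 e3 e4] := cycle_edges4 u.
move=> /hi[] -> /hj[] -> //; first by rewrite finset.setUC.
by rewrite finset.setUC.
Qed.

Lemma disjoint_tri_quad i j :
  (finset.cover (cycle_edges (tri_cycle i j)) :&: finset.cover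
    (cycle_edges (quad_cycle i j)) = finset.set0)%SET.
Proof.
have [i1 i2 _ _] := ord3_next i; have [j1 j2 _ _] := ord3_next j.
apply/setP => x; rewrite !inE; apply/negP =>
  /andP[/cover_cycle_edges xt /cover_cycle_edges].
apply/negP; move: xt; rewrite !inE => /or3P[] /eqP ->; rewrite !negb_or.
- by rewrite !neq_zv !neq_zw.
- by rewrite !neq_vw !neq_v // eq_sym.
- by rewrite ![w _ == v _]eq_sym !neq_vw !neq_w // eq_sym.
Qed.

(** If all nine pairs were split, sufficiently fine generic approximations of the
    nine pairs of cycles would have linking parity 0, against [K331_linking]. *)
Lemma K331_link : exists P, is_link f P.
Proof.
apply: contrapT => nolink.
pose cycle_pair i j := (cycle_edges (tri_cycle i j), cycle_edges (quad_cycle i j)).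
have split_ij i j : split_by_sphere (cycle_image f (cycle_pair i j).1)
  (cycle_image f (cycle_pair i j).2).
  apply: contrapT => ns; apply: nolink; exists [set (cycle_pair i j).1;
    (cycle_pair i j).2]%SET.
  exists (cycle_pair i j).1, (cycle_pair i j).2; split=> //.
  - by exists (tri_cycle i j); split=> //; exact: cycle_tri.
  - by exists (quad_cycle i j); split=> //; exact: cycle_quad.
  - exact: disjoint_tri_quad.
have eps_ij (p : 'I_3 * 'I_3) : exists e : R, 0 < e /\ forall S o E F, generic S ->
  apart S o E F ->
    closed_chain E -> closed_chain F -> near_chain
      (cycle_image f (cycle_pair p.1 p.2).1) e E ->
    near_chain (cycle_image f (cycle_pair p.1 p.2).2) e F -> linking E F = false.
  have [e e0 he] := split_linking (split_ij p.1 p.2)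
    (compact_cycle_image cf (cycle_tri p.1 p.2))
      (compact_cycle_image cf (cycle_quad p.1 p.2)).
  by exists e.
have [eps heps] := choice eps_ij.
have [e e0 he] : exists2 e : R, 0 < e & forall p, e <= eps p.
  exists (\big[Num.min/1]_p eps p).
    by apply: lt_bigmin => // p _; have [] := heps p.
  by move=> p; apply: bigmin_le_cond.
(* A third for each end of a perturbed edge, and one for the step between samples. *)
have e30 : 0 < e / 3%:R by rewrite divr_gt0.
have [n n0 hn] := sample_step cf e30.
have g0 : generic ([::] : seq 'rV[R]_3) by [].
have [phi [near_phi gen_phi inj_phi _]] := generic_extend (all_nodes G n) (sample f n)
  g0 e30.
have [q [_ qS gS]] := generic_near 0 gen_phi e30.
rewrite cats0 in qS gS; set S := q :: _ in gS.
have distinct_phi (s : seq (G * G * nat)) : uniq s -> all (mem (all_nodes G n)) s ->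
    distinct_in S (q :: map phi s).
  move=> us /allP sL; apply/andP; split.
    rewrite /= map_inj_in_uniq ?us ?andbT; last by move=> a b /sL ? /sL ?;
      apply: inj_phi.
    by apply: contra qS => /mapP[a /sL aL ->]; rewrite map_f.
  by apply/allP => p; rewrite inE => /predU1P[->|/mapP[a /sL aL ->]];
    rewrite inE ?eqxx // map_f ?orbT.
pose path x y : seq ('rV[R]_3 * 'rV[R]_3) := map_chain phi (edge_path n x y).
pose V x : 'rV[R]_3 := phi (x, x, 0%N).
have node0 x : (x, x, 0%N) \in all_nodes G n.
  by rewrite -[(x, x, 0%N)]/(node n x x 0) node_all.
pose on_edge x y (p : (G * G * nat) * (G * G * nat)) := [/\ p.1 \in all_nodes G n,
  p.2 \in all_nodes G n, p.1.1.1 \in [:: x; y], p.2.1.1 \in [:: x; y] & p.1 != p.2].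
have on_path x y p : x != y -> p \in edge_path n x y -> on_edge x y p.
  move=> xy /mapP[k]; rewrite mem_iota add0n => /andP[_ kn] ->.
  by split; rewrite /= ?node_all ?node_fst ?node_neq // ltnW.
have apart_edges x y x' y' p p' : uniq [:: x; y; x';
  y'] -> on_edge x y p -> on_edge x' y' p' ->
    distinct_in S [:: q; phi p.1; phi p.2; phi p'.1; phi p'.2].
  move=> u [p1 p2 p1x p2x p12] [q1 q2 q1x q2x q12].
  have ne (a b : G * G * nat) : a.1.1 \in [:: x; y] -> b.1.1 \in [:: x'; y'] -> a != b.
    have [xx xy yx yy] : [/\ x != x', x != y', y != x' & y != y'] by split;
      distinct_from u.
    move=> + bx; apply: contraTneq => ->; move: bx; rewrite !inE => /orP[] /eqP ->;
      by rewrite ![_ == x]eq_sym ![_ == y]eq_sym negb_or ?xx ?xy ?yx ?yy.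
  have n11 := ne _ _ p1x q1x; have n12 := ne _ _ p1x q2x.
  have n21 := ne _ _ p2x q1x; have n22 := ne _ _ p2x q2x.
  apply: (distinct_phi [:: p.1; p.2; p'.1; p'.2]); last by rewrite /= p1 p2 q1 q2.
  by rewrite /= !inE !negb_or p12 n11 n12 n21 n22 q12.
have span_path x y : spans (path x y) (V x) (V y).
  move=> g; rewrite /boundary /path /map_chain !big_map /=.
  rewrite (xor_telescope (fun k => g (phi (node n x y k)))).
  by rewrite /node /= eqxx; case: eqP => [e1|//]; rewrite e1 in n0.
have near_path x y c : adj x y -> [set x; y]%SET \in cycle_edges c ->
    near_chain (cycle_image f (cycle_edges c)) e (path x y).
  move=> xy xyc s /mapP[p /mapP[k]]; rewrite mem_iota add0n => /andP[_ kn] -> -> /=.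
  have inA j : (j <= n)%N -> cycle_image f (cycle_edges c) (sample f n (node n x y j)).
    move=> jn; exists x, y; split=> //; rewrite sample_node //.
    eexists; last by []. exists (j%:R / n%:R) => //=.
    by rewrite in_itv /= divr_ge0 //= ler_pdivrMr ?ltr0n // mul1r ler_nat.
  have kn' := ltnW kn.
  have h1 := near_phi _ (node_all x y kn' n0);
    have h2 := near_phi _ (node_all x y kn n0).
  have h3 := hn x y k xy kn.
  split.
  - have := ler_distD (sample f n (node n x y k)) (phi (node n x y k))
    (phi (node n x y k.+1)).
    have := ler_distD (sample f n (node n x y k.+1)) (sample f n (node n x y k))
      (phi (node n x y k.+1)).
    by rewrite [X in _ <= _ + X -> _]distrC; lra.
  - by exists (sample f n (node n x y k)); [exact: inA | rewrite distrC; lra].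
  - by exists (sample f n (node n x y k.+1)); [exact: inA | rewrite distrC; lra].
pose E i j := path (v i) (w j); pose A i := path z (v i); pose B j := path z (w j).
have path_apart x y x' y' : uniq [:: x; y; x'; y'] ->
    apart S q (path x y) ((V x', V y') :: path x' y').
  move=> u a b /mapP[p /on_path px ->] bx.
  have xy : x != y by distinct_from u.
  have xy' : x' != y' by distinct_from u.
  move: bx; rewrite inE => /predU1P[->|/mapP[p' /on_path px' ->]] /=; last first.
    exact: apart_edges u (px xy) (px' xy').
  apply: (apart_edges x y x' y' p ((x', x', 0%N), (y', y', 0%N)) u (px xy)).
  split; rewrite /= ?node0 ?inE ?eqxx ?orbT //.
  by rewrite !xpair_eqE (negPf xy').
have uniq_vwvw i j k l : i != k -> j != l -> uniq [:: v i; w j; v k; w l].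
  move=> ik jl; rewrite /= !inE !negb_or !neq_vw neq_v // neq_w // andbT.
  by rewrite eq_sym neq_vw.
have : \xor_i \xor_j linking (triangle E A B i j) (square E i j) = true.
  apply: (K331_linking gS (o := q) (v := V \o v) (w := V \o w)).
  - by move=> i j; exact: span_path.
  - by move=> i j k l ik jl; apply: path_apart; exact: uniq_vwvw.
  - move=> i; apply: (distinct_phi [:: (v i, v i, 0%N); (w ord0, w ord0, 0%N);
      (w (lift ord0 ord0), w (lift ord0 ord0), 0%N); (w ord_max, w ord_max, 0%N)]).
      rewrite /= !inE !xpair_eqE !eqxx !andbT !andbb !negb_or !neq_vw /=.
      by rewrite !neq_w.
    by rewrite /= !node0.
rewrite big1 // => i _; rewrite big1 // => j _.
have in_square s : s \in square E i j -> exists k l, [/\ k != i, l != j & s \in E k l].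
  by move=> /mem_big_cat[k ki /mem_big_cat[l lj sE]]; exists k, l.
have [_ /(_ S q)] := heps (i, j); apply=> //.
- move=> s s' + /in_square[k [l [ki lj s'E]]].
  have [ik jl] : i != k /\ j != l by rewrite ![_ == k]eq_sym ![_ == l]eq_sym.
  have {}s'E : s' \in (V (v k), V (w l)) :: path (v k) (w l) by rewrite inE s'E orbT.
  rewrite !mem_cat => /or3P[] sT; apply: path_apart sT s'E.
  + by rewrite /= !inE !negb_or !neq_zv neq_zw neq_v // !neq_vw.
  + exact: uniq_vwvw.
  + by rewrite /= !inE !negb_or neq_zv !neq_zw neq_w // [w j == _]eq_sym !neq_vw.
- move=> g; rewrite /triangle !boundary_cat !span_path.
  by case: (g _); case: (g _); case: (g _).
- move=> g; rewrite /square.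
  have b0 : boundary ([::] : seq ('rV[R]_3 * 'rV[R]_3)) g = false by rewrite /boundary
    big_nil.
  have bm : {morph (fun F => boundary F g) : F1 F2 / F1 ++ F2 >-> F1 (+) F2}.
    by move=> F1 F2; rewrite boundary_cat.
  rewrite (big_morph _ bm b0).
  transitivity (\xor_(k | k != i) \xor_(l | l != j) (g (V (v k)) (+) g (V (w l)))).
    apply: eq_bigr => k _; rewrite (big_morph _ bm b0).
    by apply: eq_bigr => l _; exact: span_path.
  rewrite (eq_bigr (fun k => \xor_(l | l != j) g (V (w l)))) ?xor_const2 // => k _.
  by rewrite big_split xor_const2.
- have [e1 e2 e3] := cycle_edges3 (andP (cycle_tri i j)).2.
  apply: (near_chainW (he _)); apply: near_chain_cat; first exact: near_path.
  apply: near_chain_cat; first exact: near_path.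
  by apply: near_path; rewrite // finset.setUC.
- apply: (near_chainW (he _)) => s /in_square[k [l [ki lj sE]]].
  exact: near_path (quad_edges ki lj) _ sE.
Qed.

End LowerBound.

(** * Spheres as level sets of gauges *)

Section Gauge.
Variable R : realType.
Local Notation pt := 'rV[R]_3.
Implicit Types (a b c d p q x y : pt) (g : pt -> R).

(** Minkowski functionals of star-shaped neighbourhoods of 0, the last clause saying
    that the neighbourhood is bounded. *)
Definition gauge g : Prop := [/\ continuous g,
  forall (t : R) x, 0 <= t -> g (t *: x) = t * g x &
  exists2 c : R, 0 < c & forall x, c * `|x| <= g x].

Lemma gauge0 g : gauge g -> g 0 = 0.
Proof. by move=> [_ hZ _]; rewrite -(scale0r 0) hZ ?mul0r. Qed.

Lemma gauge_gt0 g x : gauge g -> x != 0 -> 0 < g x.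
Proof.
move=> [_ _ [c c0 hc]] x0; apply: lt_le_trans (hc x).
by rewrite mulr_gt0 // normr_gt0.
Qed.

Lemma gauge_ge0 g x : gauge g -> 0 <= g x.
Proof.
move=> gg; have [->|x0] := eqVneq x 0; first by rewrite gauge0.
exact/ltW/gauge_gt0.
Qed.

(** The radial map that carries the unit ball of the gauge g1 onto that of g2. *)
Definition regauge g1 g2 x : pt := (g1 x / g2 x) *: x.

Lemma regaugeE g1 g2 x : gauge g1 -> gauge g2 -> g2 (regauge g1 g2 x) = g1 x.
Proof.
move=> h1 h2; have [_ hZ _] := h2.
have [->|x0] := eqVneq x 0; first by rewrite /regauge scaler0 !gauge0.
by rewrite hZ ?divr_ge0 ?gauge_ge0 // mulfVK // gt_eqF // gauge_gt0.
Qed.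

Lemma regaugeK g1 g2 : gauge g1 -> gauge g2 -> cancel (regauge g1 g2) (regauge g2 g1).
Proof.
move=> h1 h2 x; rewrite {1}/regauge regaugeE //.
have [->|x0] := eqVneq x 0; first by rewrite /regauge !scaler0.
have n1 : g1 x != 0 by rewrite gt_eqF // gauge_gt0.
have n2 : g2 x != 0 by rewrite gt_eqF // gauge_gt0.
have [_ hZ _] := h1; rewrite /regauge hZ ?divr_ge0 ?gauge_ge0 // scalerA.
rewrite (_ : _ * _ = 1) ?scale1r //.
by field; rewrite n1 n2.
Qed.

(** At 0 the quotient need not have a limit, but it is at most g1 x / (c |x|). *)
Lemma regauge_continuous g1 g2 : gauge g1 -> gauge g2 -> continuous (regauge g1 g2).
Proof.
move=> h1 h2 x; have [c1 _ _] := h1; have [c2 _ [c c0 hc]] := h2.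
have [->|x0] := eqVneq x 0.
  apply/continuous_epsP => e e0.
  have ce0 : 0 < c * e by rewrite mulr_gt0.
  have [d d0 hd] := (continuous_epsP g1 0).1 (c1 0) _ ce0.
  exists d => // y /hd; rewrite /regauge scaler0 !sub0r !normrN gauge0 // sub0r normrN.
  rewrite ger0_norm ?gauge_ge0 // => g1y.
  have [->|y0] := eqVneq y 0; first by rewrite scaler0 normr0.
  have g2y := gauge_gt0 h2 y0.
  rewrite normrZ ger0_norm ?divr_ge0 ?gauge_ge0 // mulrAC ltr_pdivrMr //.
  apply: le_lt_trans (_ : g1 y * (g2 y / c) < _).
    by rewrite ler_wpM2l ?gauge_ge0 // ler_pdivlMr // mulrC.
  by rewrite mulrA ltr_pdivrMr // mulrAC ltr_pM2r // mulrC.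
have n2 : g2 x != 0 by rewrite gt_eqF // gauge_gt0.
have cq : {for x, continuous (fun y => g1 y / g2 y)}.
  exact: (continuousM (c1 x) (continuousV n2 (c2 x))).
exact: (continuousZ cq cvg_id).
Qed.

Definition euclid x : R := Num.sqrt (sqnorm x).

Lemma gauge_euclid : gauge euclid.
Proof.
split.
- move=> x; apply: continuous_comp; first exact: continuous_sqnorm.
  exact: sqrt_continuous.
- by move=> t x t0; rewrite /euclid sqnormZ sqrtrM ?sqr_ge0 // sqrtr_sqr ger0_norm.
- exists 1 => // x; rewrite mul1r [leLHS]/Num.norm /= mx_normrE.
  apply/bigmax_leP; split; first exact: sqrtr_ge0.
  move=> [i j] _ /=; rewrite ord1 -sqrtr_sqr; apply: ler_wsqrtr.
  by rewrite /sqnorm (bigD1 j) //= lerDl; apply: sumr_ge0 => k _; rewrite sqr_ge0.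
Qed.

Lemma split_by_gauge g p (A B : set pt) : gauge g ->
  (forall x, A x -> g (x - p) < 1) -> (forall x, B x -> 1 < g (x - p)) ->
  split_by_sphere A B.
Proof.
move=> gg hA hB; have ge := gauge_euclid.
pose k x := p + regauge euclid g x; pose k' y := regauge g euclid (y - p).
exists k; split.
  exists k'; split.
  - by move=> x; rewrite /k' /k addrC addKr regaugeK.
  - by move=> y; rewrite /k' /k regaugeK // addrC subrK.
  - move=> x; have cx := regauge_continuous ge gg (x := x).
    exact: (continuousD (cvg_cst p) cx).
  - move=> y; apply: (continuous_comp (f := fun y => y - p)).
      apply: (@continuousB _ _ _ id (fun=> p)); [exact: cvg_id | exact: cst_continuous].
    exact: regauge_continuous.
left; split=> x.
- move=> /hA h; exists (k' x); last by rewrite /k /k' regaugeK // addrC subrK.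
  move: h; rewrite /k' -(regaugeE (x - p) gg ge) /euclid /=.
  by rewrite -[X in _ < X]sqrtr1 ltr_sqrt.
- move=> /hB h; exists (k' x); last by rewrite /k /k' regaugeK // addrC subrK.
  move: h; rewrite /k' -(regaugeE (x - p) gg ge) /euclid /=.
  by move=> h; rewrite ltNge; apply/negP => h'; move: h;
    rewrite ltNge -sqrtr1 ler_wsqrtr.
Qed.

End Gauge.

(** * A sphere around a flat triangle *)

Section FlatTriangle.
Variable R : realType.
Local Notation pt := 'rV[R]_3.
Implicit Types (a b c d p q u v x y : pt).

Definition dot u v : R := cx u * cx v + cy u * cy v + cz u * cz v.

(** The gradient of [vol a b c]. *)
Definition normal a b c : pt := \row_(i < 3) [::
  (cy b - cy a) * (cz c - cz a) - (cz b - cz a) * (cy c - cy a);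
  (cz b - cz a) * (cx c - cx a) - (cx b - cx a) * (cz c - cz a);
  area a b c]`_i.

Lemma dotZl (t : R) u v : dot (t *: u) v = t * dot u v.
Proof. by rewrite /dot /cx /cy /cz !mxE; ring. Qed.
Lemma dotZr (t : R) u v : dot u (t *: v) = t * dot u v.
Proof. by rewrite /dot /cx /cy /cz !mxE; ring. Qed.

Lemma continuous_dot u : continuous (dot u).
Proof.
have cc (k : R) i : continuous (fun x : pt => k * x ord0 i).
  move=> x; apply: (continuous_comp (f := fun y : pt => y ord0 i)
    (g := fun t => k * t)).
    exact: coord_continuous.
  exact: mulrl_continuous.
by move=> x; exact: (continuousD (continuousD (cc _ _ x) (cc _ _ x)) (cc _ _ x)).
Qed.

Definition max_dot (L : seq pt) v : R := \big[Num.max/0]_(u <- L) dot u v.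

Lemma max_dot_cons u L v : max_dot (u :: L) v = Num.max (dot u v) (max_dot L v).
Proof. by rewrite /max_dot big_cons. Qed.

Lemma gauge_max_dot L (c : R) : 0 < c -> (forall x, c * `|x| <= max_dot L x) ->
  gauge (max_dot L).
Proof.
move=> c0 hc; split; last by exists c.
- elim: L {hc} => [|u L IH] x.
    rewrite (_ : max_dot [::] = fun=> 0); first exact: cst_continuous.
    by apply/funext => y; rewrite /max_dot big_nil.
  rewrite (_ : max_dot (u :: L) = fun y => Num.max (dot u y) (max_dot L y)).
    by apply: (@continuous_max R _ (dot u) (max_dot L));
      [exact: continuous_dot | exact: IH].
  by apply/funext => y; exact: max_dot_cons.
- move=> t x t0; elim: L {hc} => [|u L IH]; first by rewrite /max_dot !big_nil mulr0.
  by rewrite !max_dot_cons IH dotZr maxr_pMr.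
Qed.

Lemma dot_le_max L u v : u \in L -> dot u v <= max_dot L v.
Proof.
elim: L => // w L IH; rewrite inE max_dot_cons le_max => /predU1P[->|/IH ->].
  by rewrite lexx.
by rewrite orbT.
Qed.

Lemma max_dot_lt1 L v : (forall u, u \in L -> dot u v < 1) -> max_dot L v < 1.
Proof.
elim: L => [|w L IH] h; first by rewrite /max_dot big_nil ltr01.
rewrite max_dot_cons gt_max h ?mem_head // IH // => u uL.
by apply: h; rewrite inE uL orbT.
Qed.

Section Barycentric.
Variables (a b c d : pt).
Hypothesis D0 : vol a b c d != 0.

(** For affinely independent a, b, c, d, the gradients of the four barycentric
    coordinates, and the coordinates [coord_a], ..., themselves. *)
Definition bary_a : pt := - (vol a b c d)^-1 *: normal b c d.
Definition bary_b : pt := (vol a b c d)^-1 *: normal a c d.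
Definition bary_c : pt := - (vol a b c d)^-1 *: normal a b d.
Definition bary_d : pt := (vol a b c d)^-1 *: normal a b c.

Local Ltac bary_ring k :=
  rewrite /bary_a /bary_b /bary_c /bary_d -/k /vol /dot /normal /area /cx /cy /cz
    !mxE /=; ring.

Lemma bary_sum v : dot bary_a v + dot bary_b v + dot bary_c v + dot bary_d v = 0.
Proof. set k := (vol a b c d)^-1; bary_ring k. Qed.

Lemma bary_decomp v : v = dot bary_a v *: a + dot bary_b v *: b +
  dot bary_c v *: c + dot bary_d v *: d.
Proof.
set k := (vol a b c d)^-1; have kD : vol a b c d * k = 1 by rewrite mulfV.
by apply: row3P; rewrite -[LHS]mul1r -kD; bary_ring k.
Qed.

Definition coord_a x : R := dot bary_a (x - b).
Definition coord_b x : R := dot bary_b (x - c).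
Definition coord_c x : R := dot bary_c (x - a).
Definition coord_d x : R := dot bary_d (x - a).

Lemma coord_sum x : coord_a x + coord_b x + coord_c x + coord_d x = 1.
Proof.
set k := (vol a b c d)^-1; have kD : vol a b c d * k = 1 by rewrite mulfV.
by rewrite -[RHS]kD /coord_a /coord_b /coord_c /coord_d; bary_ring k.
Qed.

Lemma coord_point x : x = coord_a x *: a + coord_b x *: b + coord_c x *: c + coord_d x
  *: d.
Proof.
set k := (vol a b c d)^-1; have kD : vol a b c d * k = 1 by rewrite mulfV.
rewrite /coord_a /coord_b /coord_c /coord_d.
by apply: row3P; rewrite -[LHS]mul1r -kD; bary_ring k.
Qed.

Lemma coord_in_plane (r s t : R) : r + s + t = 1 ->
  let x := r *: a + s *: b + t *: c in
  [/\ coord_a x = r, coord_b x = s, coord_c x = t & coord_d x = 0].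
Proof.
move=> e /=; have -> : t = 1 - r - s by rewrite -e; ring.
set k := (vol a b c d)^-1; have kD : vol a b c d * k = 1 by rewrite mulfV.
rewrite /coord_a /coord_b /coord_c /coord_d.
split; first by rewrite -[RHS]mulr1 -[in RHS]kD; bary_ring k.
- by rewrite -[RHS]mulr1 -[in RHS]kD; bary_ring k.
- transitivity ((1 - r - s) * (vol a b c d * k)); last by rewrite kD mulr1.
  by bary_ring k.
- by bary_ring k.
Qed.

Definition triangle_set : set pt := [set x | exists r s t : R,
  [/\ 0 <= r, 0 <= s, 0 <= t, r + s + t = 1 & x = r *: a + s *: b + t *: c]].

(** In the unit ball of the corresponding gauge, centred at the centroid of a b c,
    the first three coordinates are greater than - h and the last one is between - h
    and h: the triangle slightly enlarged and thickened. *)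
Definition plate (h : R) : seq pt :=
  [:: - (3%:R^-1 + h)^-1 *: bary_a; - (3%:R^-1 + h)^-1 *: bary_b;
      - (3%:R^-1 + h)^-1 *: bary_c; h^-1 *: bary_d; - h^-1 *: bary_d].

(** The coordinates of a displacement sum to 0.  Three lower bounds and a two-sided
    bound on the last one therefore bound all of them, hence the displacement. *)
Lemma gauge_plate (h : R) : 0 < h -> gauge (max_dot (plate h)).
Proof.
move=> h0; set s : R := 3%:R^-1 + h.
have s0 : 0 < s by rewrite addr_gt0 // invr_gt0.
pose M := `|a| + `|b| + `|c| + `|d| + 1.
have M0 : 0 < M by rewrite ltr_wpDl ?addr_ge0.
pose K := (2%:R * s + h) * M.
have K0 : 0 < K by rewrite mulr_gt0 // addr_gt0 // mulr_gt0.
apply: (@gauge_max_dot _ K^-1); first by rewrite invr_gt0.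
move=> x; rewrite mulrC ler_pdivrMr //; set g := max_dot _ x.
have bound u : u \in plate h -> dot u x <= g by exact: dot_le_max.
have ha : - dot bary_a x <= s * g.
  have := bound _ (mem_head _ _); rewrite dotZl mulNr -/s -mulrN mulrC.
  by rewrite ler_pdivrMr // mulrC.
have hb : - dot bary_b x <= s * g.
  have : dot (- s^-1 *: bary_b) x <= g by apply: bound; rewrite !inE eqxx ?orbT.
  by rewrite dotZl mulNr -mulrN mulrC ler_pdivrMr // mulrC.
have hc : - dot bary_c x <= s * g.
  have : dot (- s^-1 *: bary_c) x <= g by apply: bound; rewrite !inE eqxx ?orbT.
  by rewrite dotZl mulNr -mulrN mulrC ler_pdivrMr // mulrC.
have hd : dot bary_d x <= h * g.
  have : dot (h^-1 *: bary_d) x <= g by apply: bound; rewrite !inE eqxx ?orbT.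
  by rewrite dotZl mulrC ler_pdivrMr // mulrC.
have hd' : - dot bary_d x <= h * g.
  have : dot (- h^-1 *: bary_d) x <= g by apply: bound; rewrite !inE eqxx ?orbT.
  by rewrite dotZl mulNr -mulrN mulrC ler_pdivrMr // mulrC.
have sum0 := bary_sum x.
have g0 : 0 <= g by rewrite -(pmulr_rge0 _ h0); lra.
have sg0 : 0 <= s * g by rewrite mulr_ge0 // ltW.
have hg0 : 0 <= h * g by rewrite mulr_ge0 // ltW.
have e : (2%:R * s + h) * g = s * g + s * g + h * g by ring.
have na : `|dot bary_a x| <= (2%:R * s + h) * g by rewrite ler_norml e; apply/andP;
  split; lra.
have nb : `|dot bary_b x| <= (2%:R * s + h) * g by rewrite ler_norml e; apply/andP;
  split; lra.
have nc : `|dot bary_c x| <= (2%:R * s + h) * g by rewrite ler_norml e; apply/andP;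
  split; lra.
have nd : `|dot bary_d x| <= (2%:R * s + h) * g by rewrite ler_norml e; apply/andP;
  split; lra.
rewrite [X in `|X| <= _]bary_decomp.
apply: le_trans (_ : (2%:R * s + h) * g * (`|a| + `|b| + `|c| + `|d|) <= _).
  move: (_ * g) na nb nc nd => Y na nb nc nd.
  rewrite !mulrDr; do 3 (apply: le_trans (ler_normD _ _) _; apply: lerD;
    last by rewrite normrZ ler_wpM2r).
  by rewrite normrZ ler_wpM2r.
rewrite /K mulrCA mulrA; apply: ler_wpM2l; last by rewrite /M lerDl ler01.
by rewrite mulr_ge0 // addr_ge0 ?mulr_ge0 // ltW.
Qed.

(** Outside the triangle one of the defining inequalities fails.  By compactness it
    fails on B by at least some h > 0, and the plate of that thickness works. *)
Lemma split_flat_triangle (A B : set pt) : A `<=` triangle_set -> compact B ->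
  (forall x, triangle_set x -> ~ B x) -> split_by_sphere A B.
Proof.
move=> AT cB TB.
pose L : seq (pt * pt) := [:: (- 1 *: bary_a, b); (- 1 *: bary_b, c);
  (- 1 *: bary_c, a);
  (bary_d, a); (- 1 *: bary_d, a)].
have [|h h0 hh] := compact_scale
    (P := fun h x => exists2 p : pt * pt, p \in L & h < dot p.1 (x - p.2)) cB.
  move=> x Bx.
  have [p pL p0] : exists2 p : pt * pt, p \in L & 0 < dot p.1 (x - p.2).
    apply: contrapT => no; apply: (TB x) => //.
    have le0 (p : pt * pt) : p \in L -> dot p.1 (x - p.2) <= 0.
      by move=> pL; rewrite leNgt; apply/negP => p0; apply: no; exists p.
    have h1 : 0 <= coord_a x.
      have := le0 (- 1 *: bary_a, b); rewrite !inE eqxx => /(_ isT).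
      by rewrite dotZl mulN1r oppr_le0.
    have h2 : 0 <= coord_b x.
      have := le0 (- 1 *: bary_b, c); rewrite !inE eqxx ?orbT => /(_ isT).
      by rewrite dotZl mulN1r oppr_le0.
    have h3 : 0 <= coord_c x.
      have := le0 (- 1 *: bary_c, a); rewrite !inE eqxx ?orbT => /(_ isT).
      by rewrite dotZl mulN1r oppr_le0.
    have h4 : coord_d x = 0.
      apply/eqP; rewrite eq_le; apply/andP; split.
        by have := le0 (bary_d, a); rewrite !inE eqxx ?orbT => /(_ isT).
      have := le0 (- 1 *: bary_d, a); rewrite !inE eqxx ?orbT => /(_ isT).
      by rewrite dotZl mulN1r oppr_le0.
    exists (coord_a x), (coord_b x), (coord_c x); split=> //.
      by rewrite -(coord_sum x) h4 addr0.
    by rewrite {1}(coord_point x) h4 scale0r addr0.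
  set t := dot _ _ in p0; have t20 : 0 < t / 2 by rewrite divr_gt0.
  have [e e0 he] := (continuous_epsP _ _).1 (@continuous_dot p.1 (x - p.2)) _ t20.
  exists (Num.min e (t / 2)); first by rewrite lt_min e0.
  move=> y r; rewrite !lt_min => /andP[xy _] /and3P[r0 _ rt]; exists p => //.
  have := he (y - p.2); rewrite opprB addrA subrK => /(_ xy).
  by rewrite -/t ltr_norml => /andP[]; lra.
have s0 : 0 < 3%:R^-1 + h by rewrite addr_gt0 // invr_gt0.
pose m := 3%:R^-1 *: a + 3%:R^-1 *: b + 3%:R^-1 *: c.
have e3 : 3%:R^-1 + 3%:R^-1 + 3%:R^-1 = 1 :> R by field.
have [ma mb mc md] := coord_in_plane e3; rewrite -/m in ma mb mc md.
have shift u p x : dot u (x - m) = dot u (x - p) - dot u (m - p).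
  by rewrite /dot /cx /cy /cz !mxE; ring.
have da x : dot bary_a (x - m) = coord_a x - 3%:R^-1 by rewrite (shift _ b)
  -/(coord_a m) ma.
have db x : dot bary_b (x - m) = coord_b x - 3%:R^-1 by rewrite (shift _ c)
  -/(coord_b m) mb.
have dc x : dot bary_c (x - m) = coord_c x - 3%:R^-1 by rewrite (shift _ a)
  -/(coord_c m) mc.
have dd x : dot bary_d (x - m) = coord_d x by rewrite (shift _ a) -/(coord_d m) md
  subr0.
apply: (split_by_gauge (p := m) (gauge_plate h0)) => x.
  move=> /AT[r [s [t [r0 s0' t0 e ->]]]]; apply: max_dot_lt1 => u.
  have [ea eb ec ed] := coord_in_plane e.
  rewrite !inE => /or4P[|||/orP[]] /eqP ->;
    rewrite dotZl ?da ?db ?dc ?dd ?ea ?eb ?ec ?ed.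
  - by rewrite mulNr -mulrN mulrC ltr_pdivrMr //; lra.
  - by rewrite mulNr -mulrN mulrC ltr_pdivrMr //; lra.
  - by rewrite mulNr -mulrN mulrC ltr_pdivrMr //; lra.
  - by rewrite mulr0 ltr01.
  - by rewrite mulr0 ltr01.
move=> /hh[p pL hp].
suff [u uL u1] : exists2 u, u \in plate h & 1 < dot u (x - m).
  by apply: lt_le_trans u1 _; exact: dot_le_max.
move: pL hp; rewrite !inE => /or4P[|||/orP[]] /eqP -> /=;
  rewrite ?(dotZl (- 1)) ?mulN1r.
- move=> hp; exists (- (3%:R^-1 + h)^-1 *: bary_a); first by rewrite !inE eqxx ?orbT.
  by rewrite dotZl da mulNr -mulrN mulrC ltr_pdivlMr // /coord_a; lra.
- move=> hp; exists (- (3%:R^-1 + h)^-1 *: bary_b); first by rewrite !inE eqxx ?orbT.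
  by rewrite dotZl db mulNr -mulrN mulrC ltr_pdivlMr // /coord_b; lra.
- move=> hp; exists (- (3%:R^-1 + h)^-1 *: bary_c); first by rewrite !inE eqxx ?orbT.
  by rewrite dotZl dc mulNr -mulrN mulrC ltr_pdivlMr // /coord_c; lra.
- move=> hp; exists (h^-1 *: bary_d); first by rewrite !inE eqxx ?orbT.
  by rewrite dotZl dd mulrC ltr_pdivlMr // mul1r.
- move=> hp; exists (- h^-1 *: bary_d); first by rewrite !inE eqxx ?orbT.
  by rewrite dotZl dd mulNr -mulrN mulrC ltr_pdivlMr // mul1r.
Qed.

End Barycentric.
End FlatTriangle.

(** * Straight-line embeddings *)

Section StraightLine.
Variables (R : realType) (G : sgraph) (P : G -> 'rV[R]_3).
Local Notation pt := 'rV[R]_3.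
Implicit Types (u v : G) (x y : 'rV[R]_#|G|).

Definition straight x : pt := \sum_v x ord0 (enum_rank v) *: P v.

Lemma straight_comb (s t : R) x y : straight (s *: x + t *: y) = s *: straight x + t *:
  straight y.
Proof.
rewrite /straight !scaler_sumr -big_split; apply: eq_bigr => v _.
by rewrite !mxE scalerDl !scalerA.
Qed.

Lemma vertex_pointE u v : vertex_point R u ord0 (enum_rank v) = (v == u)%:R.
Proof. by rewrite mxE eqxx /= (inj_eq enum_rank_inj). Qed.

Lemma straight_vertex v : straight (vertex_point R v) = P v.
Proof.
rewrite /straight (bigD1 v) //= vertex_pointE eqxx scale1r big1 ?addr0 // => u uv.
by rewrite vertex_pointE (negPf uv) scale0r.
Qed.

Lemma straight_edge u v : straight @` edge_segment u v = segment (P u) (P v).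
Proof.
apply/seteqP; split=> [_ [_ [t t01 <-] <-]|_ [t t01 <-]].
  by exists t => //; rewrite straight_comb !straight_vertex.
exists ((1 - t) *: vertex_point R u + t *: vertex_point R v); first by exists t.
by rewrite straight_comb !straight_vertex.
Qed.

Lemma straight_continuous : continuous straight.
Proof.
move=> x; apply/continuous_epsP => e e0.
pose M : R := \sum_v `|P v| + 1.
have M0 : 0 < M by rewrite ltr_wpDl // sumr_ge0.
exists (e / M) => [|y xy]; first by rewrite divr_gt0.
have -> : straight x - straight y = \sum_v (x - y) ord0 (enum_rank v) *: P v.
  by rewrite /straight -sumrB; apply: eq_bigr => v _; rewrite !mxE scalerBl.
apply: le_lt_trans (ler_norm_sum _ _ _) _.
apply: le_lt_trans (_ : `|x - y| * M < _); last by rewrite -ltr_pdivlMr.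
rewrite /M mulrDr mulr1 mulr_sumr ler_wpDr //; apply: ler_sum => v _.
by rewrite normrZ ler_wpM2r // coord_le_norm.
Qed.

Hypothesis card_G : (3 < #|G|)%N.
Hypothesis genP : forall a b c d, uniq [:: a; b; c; d] ->
  vol (P a) (P b) (P c) (P d) != 0.

Lemma affine_indep (a b c d : pt) (r s t w : R) : vol a b c d != 0 ->
  r + s + t + w = 0 -> r *: a + s *: b + t *: c + w *: d = 0 ->
  [/\ r = 0, s = 0, t = 0 & w = 0].
Proof.
move=> D0 e0 E0.
have key (p q l : pt) (k : R) : dot (normal p q l) (r *: a + s *: b + t *: c + w *: d) =
  k * vol a b c d ->
    k = 0.
  rewrite E0 => /esym/eqP; rewrite {1}/dot /cx /cy /cz !mxE !mulr0 !addr0 mulf_eq0.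
  by rewrite (negPf D0) orbF => /eqP.
have w' : w = - r - s - t by lra.
have r0 : r = 0.
  apply: oppr_inj; rewrite oppr0; apply: (key b c d (- r)).
  by rewrite w' /dot /normal /vol /area /cx /cy /cz !mxE /=; ring.
have s0 : s = 0.
  apply: (key a c d s).
  by rewrite w' /dot /normal /vol /area /cx /cy /cz !mxE /=; ring.
have t0 : t = 0.
  apply: oppr_inj; rewrite oppr0; apply: (key a b d (- t)).
  by rewrite w' /dot /normal /vol /area /cx /cy /cz !mxE /=; ring.
by split=> //; lra.
Qed.

(** Coincidences between the vertices of two edges are absorbed by completing them to
    four distinct vertices. *)
Lemma four_vertices (s : seq G) : (size s <= 4)%N ->
  exists a b c d, uniq [:: a; b; c; d] /\ {subset s <= [:: a; b; c; d]}.
Proof.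
move=> s4; pose r := undup s ++ [seq x <- enum G | x \notin undup s].
have ur : uniq r.
  rewrite cat_uniq undup_uniq filter_uniq ?enum_uniq // andbT.
  by apply/hasPn => x; rewrite mem_filter => /andP[].
have sr : (3 < size r)%N.
  apply: leq_trans card_G _; rewrite cardE; apply: uniq_leq_size;
    first exact: enum_uniq.
  by move=> x _; rewrite mem_cat mem_filter mem_enum andbT orbN.
have : size (take 4 r) = 4%N by rewrite size_takel.
have := take_uniq 4 ur.
have : {subset s <= take 4 r}.
  move=> x; rewrite -mem_undup => xs; rewrite take_cat.
  have [h|h] := ltnP 4 (size (undup s)).
    by have := leq_trans h (leq_trans (size_undup s) s4); rewrite ltnn.
  by rewrite mem_cat xs.
case: (take 4 r) => [|a [|b [|c [|d [|]]]]] // sub u _.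
by exists a, b, c, d.
Qed.

(** Two points of the realization differ by a vector supported by at most four
    vertices, with coordinate sum 0, and four points in general position are
    affinely independent. *)
Lemma straight_injective : {in @realization R G &, injective straight}.
Proof.
move=> x y; rewrite !inE => -[u [v [_ [t _ ex]]]] [u' [v' [_ [t' _ ey]]]] exy.
have [a [b [c [d [un sub]]]]] := four_vertices (s := [:: u; v; u'; v']) isT.
pose z v : R := (x - y) ord0 (enum_rank v).
have z0 w : w \notin [:: a; b; c; d] -> z w = 0.
  move=> h; have := contra (sub w) h; rewrite !inE !negb_or => /and4P[h1 h2 h3 h4].
  rewrite /z -ex -ey !mxE !(inj_eq enum_rank_inj) !andTb.
  by rewrite (negPf h1) (negPf h2) (negPf h3) (negPf h4) !mulr0 !addr0 subrr.
have sum_z (V : lmodType R) (F : G -> V) : \sum_w z w *: F w =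
    z a *: F a + z b *: F b + z c *: F c + z d *: F d.
  rewrite (bigID (mem [:: a; b; c; d])) /= [X in _ + X]big1 ?addr0; last first.
    by move=> w /z0 ->; rewrite scale0r.
  by rewrite -big_uniq // !big_cons big_nil /= addr0 !addrA.
have sum1 u1 v1 (t1 : R) : \sum_w ((1 - t1) *: vertex_point R u1 + t1 *: vertex_point R
  v1)
    ord0 (enum_rank w) = 1.
  have dl u2 : \sum_w (vertex_point R u2 ord0 (enum_rank w)) = 1.
    rewrite (bigD1 u2) //= vertex_pointE eqxx big1 ?addr0 // => w wu.
    by rewrite vertex_pointE (negPf wu).
  rewrite (eq_bigr (fun w => (1 - t1) * vertex_point R u1 ord0 (enum_rank w) +
     t1 * vertex_point R v1 ord0 (enum_rank w))).
    by rewrite big_split -!mulr_sumr !dl !mulr1 /= subrK.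
  by move=> w _; rewrite !mxE.
have e1 : z a + z b + z c + z d = 0.
  have := sum_z R^o (fun=> 1); rewrite /GRing.scale /= !mulr1 => <-.
  rewrite (eq_bigr (fun w => x ord0 (enum_rank w) - y ord0 (enum_rank w))).
    by rewrite sumrB -ex -ey !sum1 subrr.
  by move=> w _; rewrite mulr1 /z !mxE.
have e2 : z a *: P a + z b *: P b + z c *: P c + z d *: P d = 0.
  rewrite -sum_z; have -> : \sum_w z w *: P w = straight x - straight y.
    by rewrite /straight -sumrB; apply: eq_bigr => w _; rewrite /z !mxE scalerBl.
  by rewrite exy subrr.
have [za zb zc zd] := affine_indep (genP un) e1 e2.
apply/subr0_eq/rowP => i; rewrite [RHS]mxE -[i]enum_valK -/(z (enum_val i)).
have [|h] := boolP (enum_val i \in [:: a; b; c; d]); last exact: z0.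
by rewrite !inE => /or4P[] /eqP ->.
Qed.

Lemma straight_tame : tame_embedding straight.
Proof.
split.
  by split; [apply: continuous_subspaceT;
    exact: straight_continuous | exact: straight_injective].
exists id.
  by exists id; split=> // x; exact: cvg_id.
move=> u v _; exists [:: P v]; rewrite /= !straight_vertex; split=> //.
rewrite straight_edge; apply/seteqP; split=> y; first by left.
case=> // ->; exists 1 => /=; first by rewrite in_itv /= ler01 lexx.
by rewrite subrr scale0r add0r scale1r.
Qed.

End StraightLine.

(** * Pairs of cycles split by a flat triangle *)

Section Unlinked.
Variable R : realType.
Local Notation pt := 'rV[R]_3.

Lemma segmentC n (a b : 'rV[R]_n) : segment a b = segment b a.
Proof.
suff h (c d : 'rV[R]_n) : segment c d `<=` segment d c by apply/seteqP; split; exact: h.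
move=> _ [t + <-]; rewrite /= in_itv /= => /andP[t0 t1]; exists (1 - t).
  by rewrite /= in_itv /=; apply/andP; split; lra.
by rewrite subKr addrC.
Qed.

Lemma same_sign (x y r s : R) : 0 < r -> 0 <= s -> x != 0 -> y != 0 -> r * x = s * y ->
  0 < s /\ (x < 0) = (y < 0).
Proof.
move=> r0 s0 x0 y0 e.
have s1 : 0 < s.
  rewrite lt_neqAle s0 andbT eq_sym; apply: contraNneq x0 => s00.
  by move: e; rewrite s00 mul0r => /eqP; rewrite mulf_eq0 gt_eqF.
split=> //.
by rewrite -(pmulr_rlt0 _ r0) e pmulr_rlt0.
Qed.

(** At an intersection point the barycentric coordinates are proportional to the
    volumes of p q with the opposite sides.  These volumes are nonzero, so no
    coordinate vanishes and the three signs agree. *)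
Lemma segment_misses_triangle (a b c p q : pt) :
  vol a b c p != 0 -> vol a b c q != 0 -> vol p q a b != 0 -> vol p q b c != 0 ->
  vol p q c a != 0 -> ~~ pierces a b c p q ->
  forall x, triangle_set a b c x -> ~ segment p q x.
Proof.
move=> nA nB nW nU nV /negP np x [r [s [u [r0 s0 u0 e ex]]]] [t t01 ex'].
apply: np; move: t01; rewrite /= in_itv /= => /andP[t0 t1].
have eu : u = 1 - r - s by rewrite -e; ring.
have onplane : (1 - t) * vol a b c p + t * vol a b c q = 0.
  transitivity (vol a b c ((1 - t) *: p + t *: q)).
    by rewrite /vol /cx /cy /cz !mxE /=; ring.
  by rewrite ex' ex eu /vol /cx /cy /cz !mxE /=; ring.
have line y : vol p q x y = 0.
  by rewrite -ex' /vol /cx /cy /cz !mxE /=; ring.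
have eqs : [/\ s * vol p q a b = u * vol p q c a, r * vol p q a b = u * vol p q b c &
    r * vol p q c a = s * vol p q b c].
  split; apply/eqP; rewrite -subr_eq0; apply/eqP.
  - transitivity (- vol p q x a); last by rewrite line oppr0.
    by rewrite ex eu /vol /cx /cy /cz !mxE /=; ring.
  - transitivity (vol p q x b); last by rewrite line.
    by rewrite ex eu /vol /cx /cy /cz !mxE /=; ring.
  - transitivity (- vol p q x c); last by rewrite line oppr0.
    by rewrite ex eu /vol /cx /cy /cz !mxE /=; ring.
rewrite /pierces /vol_neg; apply/and3P.
have opp : (vol a b c p < 0) (+) (vol a b c q < 0).
  move: onplane nA nB; set A := vol a b c p; set B := vol a b c q => onp nA nB.
  case: (ltrgtP A 0) nA => // hA _; case: (ltrgtP B 0) nB => // hB _.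
    by nra.
  by nra.
case: eqs => e1 e2 e3.
have sgn : (vol p q a b < 0) = (vol p q b c < 0) /\ (vol p q b c < 0) =
  (vol p q c a < 0).
  have [u1|u1] := ltP 0 u.
    have [s1 h1] := same_sign u1 s0 nV nW (esym e1).
    have [r1 h2] := same_sign u1 r0 nU nW (esym e2).
    by rewrite h1 h2.
  have u00 : u = 0 by apply/le_anti; rewrite u1 u0.
  have rs : r + s = 1 by rewrite -e u00 addr0.
  have [r1|r1] := ltP 0 r.
    have [] := same_sign r1 u0 nW nU e2; rewrite u00 ltxx; done.
  have [] := same_sign (_ : 0 < s) u0 nW nV e1; first by lra.
  by rewrite u00 ltxx.
by case: sgn => h1 h2; split; rewrite ?opp // ?h1 ?h2.
Qed.

Variables (G : sgraph) (P : G -> pt).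
Hypothesis genP : forall a b c d, uniq [:: a; b; c; d] ->
  vol (P a) (P b) (P c) (P d) != 0.

Lemma unlinked_flat (a b c : G) (s : seq G) : (1 < size s)%N ->
  ucycle (@adj G) s -> uniq ([:: a; b; c] ++ s) ->
  (forall x, x \in s -> ~~ pierces (P a) (P b) (P c) (P x) (P (next s x))) ->
  split_by_sphere (cycle_image (straight P) (cycle_edges [:: a; b; c]))
                  (cycle_image (straight P) (cycle_edges s)).
Proof.
move=> s1 cs un hs.
have [d ds] : exists d, d \in s by case: s s1 {cs un hs} => // d s' _; exists d;
  exact: mem_head.
have u4 x : x \in s -> uniq [:: a; b; c; x].
  move=> xs; have: uniq ([:: a; b; c] ++ [:: x]); last by [].
  move: un; rewrite !cat_uniq => /and3P[-> /= /hasPn h _]; rewrite andbT orbF.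
  exact: h.
apply: (split_flat_triangle (genP (u4 d ds))).
- move=> y [u [v [uv]]]; rewrite straight_edge => -[t + <-].
  rewrite /= in_itv /= => /andP[t0 t1].
  have mem w : w \in [set u; v]%SET -> w \in [:: a; b; c].
    move=> h; apply: cover_cycle_edges; apply/bigcupP.
    by exists [set u; v]%SET.
  have corner w : w \in [:: a; b; c] -> exists k1 k2 k3 : R,
    [/\ 0 <= k1, 0 <= k2, 0 <= k3,
      k1 + k2 + k3 = 1 & P w = k1 *: P a + k2 *: P b + k3 *: P c].
    rewrite !inE => /or3P[] /eqP ->.
    + by exists 1, 0, 0; rewrite ler01 lexx !addr0 scale1r !scale0r !addr0.
    + by exists 0, 1, 0; rewrite ler01 lexx addr0 add0r scale1r !scale0r addr0 add0r.
    + by exists 0, 0, 1; rewrite ler01 lexx !add0r scale1r !scale0r !add0r.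
  have [k1 [k2 [k3 [h1 h2 h3 h4 ->]]]] := corner u (mem _ (set21 _ _)).
  have [l1 [l2 [l3 [g1 g2 g3 g4 ->]]]] := corner v (mem _ (set22 _ _)).
  exists ((1 - t) * k1 + t * l1), ((1 - t) * k2 + t * l2), ((1 - t) * k3 + t * l3).
  have t1' : 0 <= 1 - t by rewrite subr_ge0.
  split; try by rewrite addr_ge0 // mulr_ge0.
    transitivity ((1 - t) * (k1 + k2 + k3) + t * (l1 + l2 + l3)); first by ring.
    by rewrite h4 g4; ring.
  by apply/rowP => i; rewrite !mxE; ring.
- apply: compact_cycle_image => //; apply: continuous_subspaceT;
  exact: straight_continuous.
- move=> y yT [u [v [/imsetP[x xs e]]]]; rewrite straight_edge => yuv.
  have nx : next s x \in s by rewrite mem_next.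
  have xn : x != next s x.
    by apply: contraTneq (next_cycle (andP cs).1 xs) => <-; rewrite adj_irr.
  have [ux us] : uniq [:: a; b; c; x] /\ uniq [:: a; b; c; next s x] by split;
    apply: u4.
  have u2 : [&& uniq [:: a; b; c; x], uniq [:: a; b; c; next s x] & x != next s x].
    by rewrite ux us.
  have miss := segment_misses_triangle (genP ux) (genP us) (genP _) (genP _) (genP _)
    (hs x xs).
  have {}miss : ~ segment (P x) (P (next s x)) y.
    by apply: miss => //; distinct_from u2.
  have hu : u \in [set x; next s x]%SET by rewrite -e set21.
  have hv : v \in [set x; next s x]%SET by rewrite -e set22.
  have hx : x \in [set u; v]%SET by rewrite e set21.
  have hn : next s x \in [set u; v]%SET by rewrite e set22.
  move: hu hv hx hn yuv; rewrite !inE => /orP[] /eqP -> /orP[] /eqP -> //.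
  + by move=> _; rewrite orbb eq_sym (negPf xn).
  + by rewrite segmentC.
  + by rewrite orbb (negPf xn).
Qed.

End Unlinked.

Lemma split_by_sphereC (R : realType) (A B : set 'rV[R]_3) :
  split_by_sphere A B -> split_by_sphere B A.
Proof. by move=> [h [hh hAB]]; exists h; split=> //; case: hAB => -[? ?];
  [right|left]. Qed.

(** * A placement with a single link *)

Local Notation G := (complete_multipartite [:: 2; 2; 1; 1; 1]%N).

(** The vertices a, a', b, b', c, d, e get the labels 0 to 6. *)
Definition label (v : G) : nat := (nth 0 [:: 0; 2; 4; 5; 6] (tag v) + tagged v)%N.
Definition part (i : nat) : nat := nth 0%N [:: 0; 0; 1; 1; 2; 3; 4]%N i.

Lemma labelP (v : G) : (label v < 7)%N /\ part (label v) = tag v.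
Proof.
case: v => [[i hi] [j hj]]; rewrite /label /=.
case: i hi j hj => [|[|[|[|[|//]]]]] hi /= [|[|//]] //=.
Qed.

Lemma label_lt v : (label v < 7)%N. Proof. by case: (labelP v). Qed.

Lemma adj_label (u v : G) : adj u v = (part (label u) != part (label v)).
Proof. by have [_ ->] := labelP u; have [_ ->] := labelP v. Qed.

Lemma label_inj : injective label.
Proof.
move=> u v e; have tuv : tag u = tag v.
  by apply: val_inj; rewrite /= -(labelP u).2 -(labelP v).2 e.
case: u v tuv e => i j [i' j'] /= tuv; subst i'.
by rewrite /label /= => /addnI/val_inj ->.
Qed.

(** Seven points, no four of them coplanar, that satisfy [check33] and [check34]. *)
Definition position (i : nat) : nat * nat * nat :=
  nth (0, 0, 0)%N [:: (6, 4, 2); (3, 6, 6); (5, 4, 3); (7, 5, 0); (2, 4, 0);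
    (7, 2, 7); (5, 5, 4)]%N i.

Definition zvol (i j k l : nat) : Z :=
  let: (x, y, z) := position i in
  let sub p := (Z.sub (Z.of_nat p.1.1) (Z.of_nat x), Z.sub (Z.of_nat p.1.2)
    (Z.of_nat y),
                Z.sub (Z.of_nat p.2) (Z.of_nat z)) in
  let: (u1, u2, u3) := sub (position j) in
  let: (v1, v2, v3) := sub (position k) in
  let: (w1, w2, w3) := sub (position l) in
  Z.add (Z.sub (Z.mul u1 (Z.sub (Z.mul v2 w3) (Z.mul v3 w2)))
               (Z.mul u2 (Z.sub (Z.mul v1 w3) (Z.mul v3 w1))))
        (Z.mul u3 (Z.sub (Z.mul v1 w2) (Z.mul v2 w1))).

Definition zvol_neg i j k l : bool := Z.ltb (zvol i j k l) 0.

Definition zpierces a b c p q : bool :=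
  [&& zvol_neg a b c p (+) zvol_neg a b c q, zvol_neg p q a b == zvol_neg p q b c &
      zvol_neg p q b c == zvol_neg p q c a].

Definition edges_of (s : seq nat) : seq (nat * nat) := zip s (rot 1 s).

Definition pierced_by (t : seq nat) : seq (nat * nat) :=
  [seq e <- [seq (i, j) | i <- iota 0 7, j <- iota 0 7] |
    if uniq (e.1 :: e.2 :: t) then
      zpierces (nth 0 t 0) (nth 0 t 1) (nth 0 t 2) e.1 e.2 else false]%N.

Definition misses (bad : seq (nat * nat)) (s : seq nat) : bool :=
  all (fun e => e \notin bad) (edges_of s).

Definition adjacent_cycle (s : seq nat) : bool := all (fun e => part e.1 != part e.2)
  (edges_of s).

(** The triangle c d e together with the 4-cycle a b a' b'. *)
Definition link_labels (t s : seq nat) : bool :=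
  [&& all (leq 4) t, all (leq^~ 3) s & let m := [seq (i < 2)%N | i <- s] in
    (m == [:: true; false; true; false]) || (m == [:: false; true; false; true])].

(** Q on all the lists obtained by putting k distinct new labels in front of r.  Here
    and below conditionals replace boolean connectives, whose two arguments would
    both be evaluated. *)
Fixpoint all_lists (k : nat) (r : seq nat) (Q : seq nat -> bool) : bool :=
  if k is k'.+1 then
    all (fun i => if i \in r then true else all_lists k' (i :: r) Q) (iota 0 7)
  else Q r.

Lemma all_listsP k r Q : all_lists k r Q ->
  forall s, size s = k -> uniq (s ++ r) -> all (fun i => (i < 7)%N) s -> Q (s ++ r).
Proof.
elim: k r => [|k IH] r; first by move=> Qr [].
move=> h s; have {}h i : (i < 7)%N -> i \notin r -> all_lists k (i :: r) Q.
  by move=> i7 /negPf ir; have := allP h i; rewrite mem_iota ir; apply.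
case: (lastP s) => [//|s' i]; rewrite size_rcons => -[ss].
rewrite cat_rcons all_rcons => us /andP[i7 s7].
apply: IH => //; apply: h => //.
by move: us; rewrite cat_uniq => /and3P[_ _ /= /andP[]].
Qed.

(** Of two disjoint triangles, one does not pierce the flat disc of the other. *)
Definition check33 (t : seq nat) : bool :=
  if ~~ adjacent_cycle t then true else let bad := pierced_by t in
  all_lists 3 t (fun l => let s := take 3 l in
    if ~~ adjacent_cycle s then true else
    if misses bad s then true else misses (pierced_by s) t).
(** The flat disc of a triangle misses every disjoint 4-cycle, but for one pair. *)
Definition check34 (t : seq nat) : bool :=
  if ~~ adjacent_cycle t then true else let bad := pierced_by t in
  all_lists 4 t (fun l => let s := take 4 l in
    if ~~ adjacent_cycle s then true else if misses bad s then true else link_labels t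
      s).

Lemma guarded_or (c m n : bool) : c ->
  (if ~~ c then true else if m then true else n) -> m || n.
Proof. by move=> ->; case: m. Qed.

Lemma check33P t s : check33 t -> adjacent_cycle t -> size s = 3%N -> uniq (s ++ t) ->
  all (fun i => (i < 7)%N) s -> adjacent_cycle s -> misses (pierced_by t) s || misses
    (pierced_by s) t.
Proof.
move=> h ct s3 us s7 cs; move: h; rewrite /check33; case: ifP; first by rewrite ct.
move=> _ /all_listsP/(_ s s3 us s7); rewrite take_size_cat //.
exact: guarded_or cs.
Qed.

Lemma check34P t s : check34 t -> adjacent_cycle t -> size s = 4%N -> uniq (s ++ t) ->
  all (fun i => (i < 7)%N) s -> adjacent_cycle s -> misses (pierced_by t) s ||
    link_labels t s.
Proof.
move=> h ct s3 us s7 cs; move: h; rewrite /check34; case: ifP; first by rewrite ct.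
move=> _ /all_listsP/(_ s s3 us s7); rewrite take_size_cat //.
exact: guarded_or cs.
Qed.

Lemma check33_all : all_lists 3 [::] check33.
Proof. by vm_compute. Qed.
Lemma check34_all : all_lists 3 [::] check34.
Proof. by vm_compute. Qed.

Definition volume_neq0 (l : seq nat) : bool :=
  zvol (nth 0 l 0) (nth 0 l 1) (nth 0 l 2) (nth 0 l 3) != Z0 :> Z.

Lemma volume_neq0_all : all_lists 4 [::] volume_neq0.
Proof. by vm_compute. Qed.

Section Placement.
Variable R : realType.

Definition point (i : nat) : 'rV[R]_3 := \row_(k < 3)
  [:: (position i).1.1%:R; (position i).1.2%:R; (position i).2%:R]`_k.

Definition place (v : G) : 'rV[R]_3 := point (label v).

Definition real_of (z : Z) : R := (int_of_Z z)%:~R.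

Lemma real_ofM x y : real_of (Z.mul x y) = real_of x * real_of y.
Proof. by rewrite /real_of -[Z.mul x y]/(x * y) rmorphM rmorphM. Qed.
Lemma real_ofB x y : real_of (Z.sub x y) = real_of x - real_of y.
Proof. by rewrite /real_of -[Z.sub x y]/(x - y) rmorphB rmorphB. Qed.
Lemma real_ofD x y : real_of (Z.add x y) = real_of x + real_of y.
Proof. by rewrite /real_of -[Z.add x y]/(x + y) rmorphD rmorphD. Qed.
Lemma real_of_nat n : real_of (Z.of_nat n) = n%:R.
Proof. by case: n => // n; rewrite /real_of /= SuccNat2Pos.id_succ. Qed.

Lemma real_of_lt0 z : (real_of z < 0) = Z.ltb z Z0.
Proof.
case: z => [|p|p]; rewrite /real_of /=.
- by rewrite ltxx.
- by rewrite ltrz0.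
- by rewrite ltrz0.
Qed.

Lemma real_of_eq0 z : (real_of z == 0) = (z == Z0).
Proof. by rewrite intr_eq0 -(inj_eq (can_inj int_of_ZK)). Qed.

Lemma vol_point i j k l : vol (point i) (point j) (point k) (point l) = real_of
  (zvol i j k l).
Proof.
rewrite /vol /zvol /cx /cy /cz !mxE /=.
case: (position i) => [[xi yi] zi]; case: (position j) => [[xj yj] zj].
case: (position k) => [[xk yk] zk]; case: (position l) => [[xl yl] zl] /=.
by rewrite !(real_ofD, real_ofB, real_ofM, real_of_nat).
Qed.

Lemma pierces_point a b c p q :
  pierces (point a) (point b) (point c) (point p) (point q) = zpierces a b c p q.
Proof. by rewrite /pierces /vol_neg !vol_point !real_of_lt0. Qed.

Lemma labels_lt (s : seq G) : all (fun i => (i < 7)%N) (map label s).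
Proof. by apply/allP => _ /mapP[v _ ->]; exact: label_lt. Qed.

Lemma place_generic (a b c d : G) : uniq [:: a; b; c; d] ->
  vol (place a) (place b) (place c) (place d) != 0.
Proof.
move=> u; rewrite vol_point real_of_eq0.
have := all_listsP volume_neq0_all (s := map label [:: a; b; c; d]).
rewrite cats0 map_inj_uniq //; last exact: label_inj.
by move=> /(_ erefl u (labels_lt _)).
Qed.

Lemma label_surj : exists h : nat -> G, forall k, (k < 7)%N -> label (h k) = k.
Proof.
pose mk i j (hi : (i < 5)%N) (hj : (j < nth 0 [:: 2; 2; 1; 1; 1] i)%N) : G :=
  @Tagged _ (Ordinal hi) (fun i : 'I_5 => 'I_(nth 0%N [:: 2; 2; 1; 1;
    1]%N i)) (Ordinal hj).
exists (fun k => nth (@mk 0%N 0%N isT isT) [:: @mk 0 0 isT isT; @mk 0 1 isT isT;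
  @mk 1 0 isT isT; @mk 1 1 isT isT; @mk 2 0 isT isT; @mk 3 0 isT isT; @mk 4 0 isT isT]%N
    k).
by do 7 (case=> //).
Qed.

Lemma card_G : (3 < #|complete_multipartite [:: 2; 2; 1; 1; 1]|)%N.
Proof.
have [h hh] := label_surj.
have inj : injective (fun i : 'I_7 => h i).
  by move=> i j /(congr1 label); rewrite !hh // => /val_inj.
by apply: leq_trans (leq_card _ inj); rewrite card_ord.
Qed.

Lemma next_zip (T : eqType) (s : seq T) x : x \in s -> (x, next s x) \in zip s
  (rot 1 s).
Proof.
move=> xs; rewrite next_nth xs; case: s xs => // y p xs; rewrite rot1_cons.
apply/(nthP (y, y)); exists (index x (y :: p)).
  by rewrite size_zip size_rcons minnn index_mem.
rewrite nth_zip ?size_rcons // nth_index // nth_rcons.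
by case: ltnP => // h; rewrite nth_default //; case: ifP.
Qed.

Lemma path_zip (T : Type) (e : rel T) x p y :
  path e x (rcons p y) = all (fun q => e q.1 q.2) (zip (x :: p) (rcons p y)).
Proof. by elim: p x => //= z p IH x; rewrite IH. Qed.

Lemma zip_map2 (T T' : Type) (f : T -> T') (s t : seq T) :
  zip (map f s) (map f t) = [seq (f p.1, f p.2) | p <- zip s t].
Proof. by elim: s t => [|x s IH] [|y t] //=; rewrite IH. Qed.

Lemma adjacent_cycle_label (c : seq G) : ucycle (@adj G) c -> adjacent_cycle
  (map label c).
Proof.
case: c => // x p /andP[cc _]; rewrite /adjacent_cycle /edges_of -map_rot zip_map2
  rot1_cons all_map.
move: cc; rewrite [cycle _ _]/= path_zip => /allP h; apply/allP => -[u v] uv.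
by rewrite /= -adj_label; exact: (h (u, v)).
Qed.

Lemma misses_split (a b c : G) (s : seq G) : (1 < size s)%N -> ucycle (@adj G) s ->
  uniq ([:: a; b; c] ++ s) -> misses (pierced_by (map label [:: a; b;
    c])) (map label s) ->
  split_by_sphere (cycle_image (straight place) (cycle_edges [:: a; b; c]))
                  (cycle_image (straight place) (cycle_edges s)).
Proof.
move=> s1 cs u /allP mi; apply: unlinked_flat => //; first exact: place_generic.
move=> x xs; rewrite pierces_point.
have nxs : next s x \in s by rewrite mem_next.
have /mi : (label x, label (next s x)) \in edges_of (map label s).
  rewrite /edges_of -map_rot zip_map2; apply/mapP.
  by exists (x, next s x); first exact: next_zip.
apply: contra => h; rewrite mem_filter; apply/andP; split; last first.
  by apply/allpairsP; exists (label x, label (next s x)); rewrite !mem_iota !label_lt.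
have xn : x != next s x.
  by apply: contraTneq (next_cycle (andP cs).1 xs) => <-; rewrite adj_irr.
have ux w : w \in s -> uniq [:: w; a; b; c].
  move=> ws; move: u; rewrite cat_uniq => /and3P[uabc /hasPn/(_ w ws) nw _].
  by rewrite cons_uniq nw uabc.
have /andP u2 := conj (ux x xs) (ux _ nxs).
rewrite [(_, _).1]/= [(_, _).2]/=; have -> // : uniq
  [:: label x, label (next s x) & map label [:: a; b; c]].
rewrite -!map_cons map_inj_uniq; last exact: label_inj.
by have /andP u3 := conj xn u2; distinct_from u3.
Qed.

(** The edge sets of the two linked cycles, described without choosing a starting
    vertex or a direction. *)
Definition link_triangle : {set {set G}} :=
  [set e : {set G} | [exists u : G, exists v : G,
  [&& u != v, (3 < label u)%N, (3 < label v)%N & e == [set u; v]%SET]]]%SET.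
Definition link_square : {set {set G}} :=
  [set e : {set G} | [exists u : G, exists v : G,
  [&& (label u < 2)%N, (1 < label v < 4)%N & e == [set u; v]%SET]]]%SET.

(** Counting: s takes as many labels as r contains. *)
Lemma label_full (r : seq nat) (s : seq G) u : uniq s -> (size r <= size s)%N ->
  all (fun v => label v \in r) s -> label u \in r -> u \in s.
Proof.
move=> us rs /allP sr ur; apply: contraTT rs => nu; rewrite -ltnNge.
have -> : (size s).+1 = size (map label (u :: s)) by rewrite size_map.
apply: uniq_leq_size; first by rewrite map_inj_uniq /= ?nu //; exact: label_inj.
by move=> _ /mapP[v + ->]; rewrite inE => /predU1P[->|/sr].
Qed.

Lemma next_neq (c : seq G) x : ucycle (@adj G) c -> x \in c -> x != next c x.
Proof.
move=> /andP[cc _] xc; apply: contraTneq (next_cycle cc xc) => <-.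
by rewrite adj_irr.
Qed.

Lemma cycle_edges_link_triangle (a b c : G) (s : seq nat) : ucycle (@adj G) [:: a; b;
  c] ->
  link_labels (map label [:: a; b; c]) s -> cycle_edges [:: a; b; c] = link_triangle.
Proof.
move=> cc /and3P[/allP h4 _ _]; have /andP[_ u] := cc.
have [e1 e2 e3] := cycle_edges3 u.
have big4 v : v \in [:: a; b; c] -> (3 < label v)%N.
  by move=> vs; exact: (h4 _ (map_f label vs)).
apply/setP => e; rewrite inE; apply/idP/existsP.
  move=> /imsetP[x xs ->]; exists x; apply/existsP; exists (next [:: a; b; c] x).
  by rewrite (next_neq cc xs) eqxx !big4 // mem_next.
move=> [x /existsP[y /and4P[xy x4 y4 /eqP ->]]].
have in_abc w : (3 < label w)%N -> w \in [:: a; b; c].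
  have lw v : (3 < label v)%N -> label v \in [:: 4; 5; 6]%N.
    by move: (label v) (label_lt v); do 7 (case=> //).
  move=> w4; apply: (label_full (r := [:: 4; 5; 6]%N)) => //; last exact: lw.
  by apply/allP => v vs; apply: lw; exact: big4.
move: (in_abc x x4) (in_abc y y4) xy; rewrite !inE.
by do 2 case/or3P => /eqP ->; rewrite ?eqxx // finset.setUC.
Qed.

Lemma cycle_edges_rot (H : sgraph) n (c : seq H) : uniq c ->
  cycle_edges (rot n c) = cycle_edges c.
Proof.
move=> uc; apply/setP => e; apply/imsetP/imsetP => -[x xc ->]; exists x;
  by rewrite ?mem_rot ?next_rot // -(mem_rot n).
Qed.

Lemma cycle_edges_link_square (t : seq nat) (p q r s : G) : ucycle (@adj G) [:: p; q; r;
  s] ->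
  link_labels t (map label [:: p; q; r; s]) -> cycle_edges [:: p; q; r;
    s] = link_square.
Proof.
move=> cc /and3P[_ /and5P[p3 q3 r3 s3 _] m].
wlog [pl rl ql sl] : p q r s cc p3 q3 r3 s3 m /
    [/\ label p < 2, label r < 2, 1 < label q < 4 & 1 < label s < 4]%N.
  move=> main; have hi x : (x < 2)%N = false -> (x <= 3)%N -> (1 < x < 4)%N.
    by move=> h h3; rewrite ltnNge -ltnS h ltnS h3.
  have /orP[] := m; rewrite /= !eqseq_cons andbT => /and4P[].
    move=> /eqP pl /eqP ql /eqP rl /eqP sl; apply: main => //.
    by split=> //; exact: hi.
  move=> /eqP pl /eqP ql /eqP rl /eqP sl.
  have cr : ucycle (@adj G) [:: q; r; s; p].
    by move: cc; rewrite -(rot_ucycle 1).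
  have /andP[_ u] := cc.
  rewrite -(cycle_edges_rot 1 u); apply: main => //.
    by rewrite /= pl ql rl sl.
  by split=> //; exact: hi.
have /andP[_ u] := cc; have [e1 e2 e3 e4] := cycle_edges4 u.
have low w : (label w < 2)%N -> w \in [:: p; r].
  move=> wl; apply: (label_full (r := [:: 0; 1]%N)) => //.
  - by distinct_from u.
  - by rewrite /= !inE; move: (label p) (label r) pl rl => [|[|//]] [|[|//]].
  - by move: (label w) wl => [|[|//]].
have high w : (1 < label w < 4)%N -> w \in [:: q; s].
  move=> wl; apply: (label_full (r := [:: 2; 3]%N)) => //.
  - by distinct_from u.
  - by rewrite /= !inE; move: (label q) (label s) ql sl => [|[|[|[|//]]]] //
    [|[|[|[|//]]]] //.
  - by move: (label w) wl => [|[|[|[|//]]]].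
have [np nq nr ns] : [/\ next [:: p; q; r; s] p = q, next [:: p; q; r; s] q = r,
    next [:: p; q; r; s] r = s & next [:: p; q; r; s] s = p].
  have [h1 h2 h3] : [/\ q != p, r != p & s != p] by split; distinct_from u.
  have [h4 h5 h6] : [/\ r != q, s != q & s != r] by split; distinct_from u.
  by split; rewrite /next /= ?(negPf h1) ?(negPf h2) ?(negPf h3) ?(negPf h4)
     ?(negPf h5) ?(negPf h6) eqxx.
apply/setP => e; rewrite inE; apply/idP/existsP.
  move=> /imsetP[x + ->]; rewrite !inE => /or4P[] /eqP ->.
  - by exists p; apply/existsP; exists q; rewrite pl ql np eqxx.
  - by exists r; apply/existsP; exists q; rewrite rl ql nq finset.setUC eqxx.
  - by exists r; apply/existsP; exists s; rewrite rl sl nr eqxx.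
  - by exists p; apply/existsP; exists s; rewrite pl sl ns finset.setUC eqxx.
move=> [x /existsP[y /and3P[/low + /high + /eqP ->]]]; rewrite !inE.
by do 2 case/orP => /eqP ->; rewrite // finset.setUC.
Qed.

(** Two disjoint cycles on seven vertices have lengths 3 and 3, or 3 and 4. *)
Lemma only_link L : is_link (straight place) L -> L = [set link_triangle;
  link_square]%SET.
Proof.
move=> [C1 [C2 [-> [c1 [s1 cc1 ->]] [c2 [s2 cc2 ->]] dis ns]]].
rewrite -/(cycle_edges c1) -/(cycle_edges c2) in dis ns *.
have dis' x : x \in c1 -> x \notin c2.
  move=> x1; apply/negP => x2.
  have cov c : x \in c -> x \in finset.cover (cycle_edges c).
    move=> xc; apply/bigcupP; exists [set x; next c x]%SET; last by rewrite !inE eqxx.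
    by apply/imsetP; exists x.
  have : x \in (finset.cover (cycle_edges c1) :&: finset.cover (cycle_edges c2))%SET.
    by rewrite finset.inE !cov.
  by rewrite dis finset.inE.
have u12 : uniq (c1 ++ c2).
  rewrite cat_uniq (andP cc1).2 (andP cc2).2 andbT; apply/hasPn => x x2.
  by apply: contraTN x2; exact: dis'.
have sz : (size c1 + size c2 <= 7)%N.
  rewrite -size_cat -(size_map label) -[7%N](size_iota 0); apply: uniq_leq_size.
    by rewrite map_inj_uniq //; exact: label_inj.
  by move=> _ /mapP[v _ ->]; rewrite mem_iota label_lt.
wlog : c1 c2 s1 s2 cc1 cc2 {dis dis'} ns u12 sz / size c1 = 3%N.
  move=> main; have [c13|c13] := eqVneq (size c1) 3; first exact: main.
  rewrite finset.setUC; apply: main => //.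
  - by move=> h; apply: ns; exact: split_by_sphereC.
  - by rewrite uniq_catC.
  - by rewrite addnC.
  - by lia.
case: c1 s1 cc1 ns u12 sz => [|a [|b [|c [|]]]] // _ cc1 ns u12 sz _.
have ut : uniq (map label [:: a; b; c]).
  by rewrite map_inj_uniq; [case/andP: cc1 | exact: label_inj].
have checkt Q : all_lists 3 [::] Q -> Q (map label [:: a; b; c]).
  move=> /all_listsP/(_ (map label [:: a; b; c])); rewrite cats0; apply=> //.
  exact: labels_lt.
have ust : uniq (map label c2 ++ map label [:: a; b; c]).
  rewrite -map_cat map_inj_uniq; last exact: label_inj.
  by rewrite uniq_catC.
have ct := adjacent_cycle_label cc1; have cs := adjacent_cycle_label cc2.
have s1 : (1 < size c2)%N by apply: ltnW.
case: (ltngtP (size c2) 3) s2 sz => // s2 _ sz.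
  have {}s2 : size c2 = 4%N by apply/eqP; rewrite eqn_leq s2 andbT -(leq_add2l 3).
  have := check34P (checkt _ check34_all) ct (_ : size (map label c2) = 4%N) ust
    (labels_lt _) cs.
  rewrite size_map => /(_ s2) /orP[mi|sp]; first by case: ns; exact: misses_split.
  rewrite (cycle_edges_link_triangle cc1 sp).
  case: c2 s2 cc2 sp {ns u12 ust cs s1 sz} => [|p [|q [|r [|s []]]]] // _ cc2 sp.
  by rewrite (cycle_edges_link_square cc2 sp).
have := check33P (checkt _ check33_all) ct (_ : size (map label c2) = 3%N) ust
  (labels_lt _) cs.
rewrite size_map => /(_ s2) /orP[mi|mi]; case: ns; first exact: misses_split.
apply: split_by_sphereC.
case: c2 s2 cc2 mi u12 {ust cs s1 sz} => [|p [|q [|r []]]] // _ cc2 mi u12.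
by apply: misses_split; rewrite // uniq_catC.
Qed.

Lemma one_link : (nb_links (straight place) <= 1)%N.
Proof.
apply: (@leq_trans #|[set [set link_triangle; link_square]%SET]%SET|);
  last by rewrite cards1.
apply: subset_leq_card; by apply/fintype.subsetP => L;
  rewrite finset.inE finset.in_set1 => /asboolP /only_link ->.
Qed.

End Placement.

Lemma links_gt0 (R : realType) (f : 'rV[R]_#|G| -> 'rV[R]_3) :
  tame_embedding f -> (0 < nb_links f)%N.
Proof.
move=> [[cf _] _]; have [h hh] := label_surj.
have adj_h i j : (i < 7)%N -> (j < 7)%N -> part i != part j -> adj (h i) (h j).
  by move=> i7 j7; rewrite adj_label !hh.
pose v (i : 'I_3) := nth 0%N [:: 0; 1; 4]%N i; pose w (i : 'I_3) := nth 0%N [:: 2; 3;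
  5]%N i.
have v7 i : (v i < 7)%N by case: i => [[|[|[|]]]].
have w7 i : (w i < 7)%N by case: i => [[|[|[|]]]].
have [L LL] : exists L, is_link f L.
  apply: (K331_link cf (z := h 6%N) (v := h \o v) (w := h \o w)).
  - move=> i j /(congr1 label); rewrite /= !hh // => e; apply: val_inj.
    by move: e; case: i => [[|[|[|//]]] ?]; case: j => [[|[|[|//]]] ?].
  - move=> i j /(congr1 label); rewrite /= !hh // => e; apply: val_inj.
    by move: e; case: i => [[|[|[|//]]] ?]; case: j => [[|[|[|//]]] ?].
  - by move=> i; apply: adj_h => //; case: i => [[|[|[|]]]].
  - by move=> i; apply: adj_h => //; case: i => [[|[|[|]]]].
  - by move=> i j; apply: adj_h => //; case: i => [[|[|[|//]]] ?];
    case: j => [[|[|[|//]]] ?].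
by apply/card_gt0P; exists L; rewrite finset.inE; apply/asboolP.
Qed.

Theorem proposition7 (R : realType) :
  mnl R (complete_multipartite [:: 2; 2; 1; 1; 1]%N) = 1%N.
Proof.
have tame0 : tame_embedding (straight (place R)).
  by apply: straight_tame; [exact: card_G | exact: place_generic].
have n1 : nb_links (straight (place R)) = 1%N.
  by apply/eqP; rewrite eqn_leq one_link links_gt0.
rewrite /mnl; case: xgetP => [m _ [[f tf <-] hm]|none].
  by apply/eqP; rewrite eqn_leq links_gt0 // andbT; have := hm _ tame0; rewrite n1.
case: (none 1%N); split; first by exists (straight (place R)).
by move=> f tf; exact: links_gt0.
Qed.
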